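(* Let $M^2$ be a generalized torus of first type in $S^3$ whose Gauss curvature is not constant. Then $M^2$ is (locally, i.e. an open piece of) a Lawson torus $\mathcal M_\alpha$ for some $\alpha>0$, $\alpha\neq 1$, where $$\mathcal M_\alpha:\ l(x,y)=(\cos x\cos\alpha y,\ \cos x\sin\alpha y,\ \sin x\cos y,\ \sin x\sin y).$$
   Context: $\mathbb R^4$ carries the standard Euclidean inner product and $S^3$ is its unit sphere. A surface in $S^3$ is minimal if its mean curvature in $S^3$ (with respect to a unit normal $n$ orthogonal to the position vector and the tangent plane) vanishes. Principal lines are the lines of curvature of the surface in $S^3$; bisectrices of the principal lines are the curves making angle $\pi/4$ with both families of principal lines. A circle is a curve in $\mathbb R^4$ with constant first Frenet curvature and vanishing higher Frenet curvatures. A generalized torus of first type is a minimal surface in $S^3$ on which one of the families of bisectrices of the principal lines is a family of circles. All considerations are local. *)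

(* Defs.v *)
From Stdlib Require Import Reals List.
From Coquelicot Require Import Coquelicot.
Open Scope R_scope.

(** Vectors of R^4 are functions nat -> R, only indices 0..3 matter. *)
Definition vec4 := nat -> R.
Definition dot4 (u v : vec4) : R :=
  u 0%nat * v 0%nat + u 1%nat * v 1%nat + u 2%nat * v 2%nat + u 3%nat * v 3%nat.

Definition open2 (U : R -> R -> Prop) : Prop :=
  forall x y, U x y -> exists eps, 0 < eps /\
    forall x' y', Rabs (x' - x) < eps -> Rabs (y' - y) < eps -> U x' y'.
Definition connected2 (U : R -> R -> Prop) : Prop :=
  forall V W : R -> R -> Prop, open2 V -> open2 W ->
    (forall x y, U x y -> V x y \/ W x y) ->
    (forall x y, U x y -> V x y -> W x y -> False) ->
    (forall x y, U x y -> V x y) \/ (forall x y, U x y -> W x y).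

Definition pdx (g : R -> R -> R) : R -> R -> R :=
  fun x y => Derive (fun t => g t y) x.
Definition pdy (g : R -> R -> R) : R -> R -> R :=
  fun x y => Derive (fun t => g x t) y.
Fixpoint pder (ds : list bool) (g : R -> R -> R) : R -> R -> R :=
  match ds with
  | nil => g
  | b :: ds' => if b then pdx (pder ds' g) else pdy (pder ds' g)
  end.
Definition smooth_on (U : R -> R -> Prop) (g : R -> R -> R) : Prop :=
  forall ds x y, U x y ->
    ex_derive (fun t => pder ds g t y) x /\
    ex_derive (fun t => pder ds g x t) y /\
    continuity_2d_pt (pder ds g) x y.

Definition surf := nat -> R -> R -> R.
Definition pt (f : surf) x y : vec4 := fun i => f i x y.
Definition fx (f : surf) x y : vec4 := fun i => pdx (f i) x y.
Definition fy (f : surf) x y : vec4 := fun i => pdy (f i) x y.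
Definition fxx (f : surf) x y : vec4 := fun i => pdx (pdx (f i)) x y.
Definition fxy (f : surf) x y : vec4 := fun i => pdy (pdx (f i)) x y.
Definition fyy (f : surf) x y : vec4 := fun i => pdy (pdy (f i)) x y.

Definition EE (f : surf) : R -> R -> R := fun x y => dot4 (fx f x y) (fx f x y).
Definition FF (f : surf) : R -> R -> R := fun x y => dot4 (fx f x y) (fy f x y).
Definition GG (f : surf) : R -> R -> R := fun x y => dot4 (fy f x y) (fy f x y).

(** First fundamental form on tangent vectors a f_x + b f_y, c f_x + d f_y. *)
Definition Iform (f : surf) x y a b c d : R :=
  a * c * EE f x y + (a * d + b * c) * FF f x y + b * d * GG f x y.

Definition unit_normal (f : surf) x y (n : vec4) : Prop :=
  dot4 n n = 1 /\ dot4 n (pt f x y) = 0 /\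
  dot4 n (fx f x y) = 0 /\ dot4 n (fy f x y) = 0.

Definition LL (f : surf) x y (n : vec4) := dot4 (fxx f x y) n.
Definition MM (f : surf) x y (n : vec4) := dot4 (fxy f x y) n.
Definition NN (f : surf) x y (n : vec4) := dot4 (fyy f x y) n.
Definition IIform (f : surf) x y n a b c d : R :=
  a * c * LL f x y n + (a * d + b * c) * MM f x y n + b * d * NN f x y n.

Definition surface_in_S3 (U : R -> R -> Prop) (f : surf) : Prop :=
  open2 U /\ connected2 U /\ (exists x y, U x y) /\
  (forall i, (i < 4)%nat -> smooth_on U (f i)) /\
  (forall x y, U x y ->
     dot4 (pt f x y) (pt f x y) = 1 /\
     EE f x y * GG f x y - FF f x y ^ 2 > 0).

(** Minimal: mean curvature (E N - 2 F M + G L)/(2(EG-F^2)) vanishes. *)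
Definition minimal_in_S3 (U : R -> R -> Prop) (f : surf) : Prop :=
  forall x y n, U x y -> unit_normal f x y n ->
    EE f x y * NN f x y n - 2 * FF f x y * MM f x y n + GG f x y * LL f x y n = 0.

(** No umbilic points (so that principal lines are defined). *)
Definition no_umbilics (U : R -> R -> Prop) (f : surf) : Prop :=
  forall x y n, U x y -> unit_normal f x y n ->
    ~ (exists lam, LL f x y n = lam * EE f x y /\ MM f x y n = lam * FF f x y /\
                   NN f x y n = lam * GG f x y).

(** (c,d) is a principal direction: eigenvector of the shape operator. *)
Definition principal_dir (f : surf) x y n c d : Prop :=
  (c <> 0 \/ d <> 0) /\
  exists lam, forall a b, IIform f x y n c d a b = lam * Iform f x y c d a b.

(** (a,b) is a bisectrix direction: angle pi/4 with every principal direction. *)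
Definition bisectrix_dir (f : surf) x y a b : Prop :=
  forall n c d, unit_normal f x y n -> principal_dir f x y n c d ->
    (Iform f x y a b c d) ^ 2 = / 2 * Iform f x y a b a b * Iform f x y c d c d.

(** Circle: unit-speed curve with constant first Frenet curvature kappa and
    vanishing second Frenet curvature: T' = kappa N, N' = - kappa T. *)
Definition frenet_circle (g : nat -> R -> R) (s0 s1 : R) : Prop :=
  exists (kappa : R) (N : nat -> R -> R),
    forall s, s0 < s < s1 ->
      (forall i, (i < 4)%nat ->
         ex_derive (g i) s /\
         is_derive (fun t => Derive (g i) t) s (kappa * N i s) /\
         is_derive (N i) s (- kappa * Derive (g i) s)) /\
      dot4 (fun i => Derive (g i) s) (fun i => Derive (g i) s) = 1 /\
      dot4 (fun i => N i s) (fun i => N i s) = 1 /\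
      dot4 (fun i => N i s) (fun i => Derive (g i) s) = 0.

(** Generalized torus of first type: minimal surface in S^3 with a family of
    bisectrices (integral curves of a unit bisectrix field) consisting of circles. *)
Definition gen_torus_first_type (U : R -> R -> Prop) (f : surf) : Prop :=
  surface_in_S3 U f /\ minimal_in_S3 U f /\ no_umbilics U f /\
  exists a b : R -> R -> R, smooth_on U a /\ smooth_on U b /\
    (forall x y, U x y ->
       Iform f x y (a x y) (b x y) (a x y) (b x y) = 1 /\
       bisectrix_dir f x y (a x y) (b x y)) /\
    (forall (c1 c2 : R -> R) (s0 s1 : R), s0 < s1 ->
       (forall s, s0 < s < s1 ->
          U (c1 s) (c2 s) /\
          is_derive c1 s (a (c1 s) (c2 s)) /\ is_derive c2 s (b (c1 s) (c2 s))) ->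
       frenet_circle (fun i s => f i (c1 s) (c2 s)) s0 s1).

(** Intrinsic Gauss curvature via the Brioschi formula. *)
Definition det3 a11 a12 a13 a21 a22 a23 a31 a32 a33 : R :=
  a11 * (a22 * a33 - a23 * a32) - a12 * (a21 * a33 - a23 * a31)
  + a13 * (a21 * a32 - a22 * a31).
Definition gauss_curv (f : surf) x y : R :=
  let E := EE f in let F := FF f in let G := GG f in
  (det3 (- / 2 * pdy (pdy E) x y + pdy (pdx F) x y - / 2 * pdx (pdx G) x y)
        (/ 2 * pdx E x y) (pdx F x y - / 2 * pdy E x y)
        (pdy F x y - / 2 * pdx G x y) (E x y) (F x y)
        (/ 2 * pdy G x y) (F x y) (G x y)
   - det3 0 (/ 2 * pdy E x y) (/ 2 * pdx G x y)
          (/ 2 * pdy E x y) (E x y) (F x y)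
          (/ 2 * pdx G x y) (F x y) (G x y))
  / (E x y * G x y - F x y ^ 2) ^ 2.

Definition lawson (alpha x y : R) : vec4 := fun i =>
  match i with
  | 0%nat => cos x * cos (alpha * y)
  | 1%nat => cos x * sin (alpha * y)
  | 2%nat => sin x * cos y
  | _ => sin x * sin y
  end.

Definition orthogonal4 (A : nat -> nat -> R) : Prop :=
  forall j k, (j < 4)%nat -> (k < 4)%nat ->
    dot4 (fun i => A i j) (fun i => A i k) = if Nat.eqb j k then 1 else 0.
Definition mat_app (A : nat -> nat -> R) (v : vec4) : vec4 :=
  fun i => dot4 (A i) v.

(* Main.v *)
(** A bisectrix of the principal directions of a minimal surface is an asymptotic direction, so
    the acceleration of a bisectrix in [R^4] has no component along the unit normal [n] of the
    surface in the sphere.  If the bisectrix is a circle with Frenet normal [N], differentiating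
    [<N, n> = 0] shows that its geodesic curvature times the (nonzero) off-diagonal entry [tau]
    of the second form vanishes: the bisectrices are great circles and the surface is ruled.

    In the frame (position, ruling direction [e1], its tangent orthogonal [e2], [n]) with dual
    forms [w1], [w2], one has [w12 = q w2], [w13 = tau w2], [w23 = tau w1], and the structure
    equations become [d tau = - 2 q tau w1], [d q = (tau^2 - 1 - q^2) w1].  Hence
    [C = (q^2 + 1 + tau^2) / tau] is constant, [C >= 2] once [tau > 0], and [C = 2] only if
    [tau = 1], that is, if [K = 1 - tau^2] vanishes identically.  For [C > 2] write
    [C = alpha + 1 / alpha]: then [/ tau - C / 2] and [q / tau] rotate with speed 2 along [w1],
    exactly as they do on the Lawson torus, and the frame solves the same skew linear system
    along every path as the frame of the Lawson torus.  Uniqueness for that system, applied along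
    segments parallel to the axes, shows that the set of points where the two frames match for
    some parameters is both open and closed. *)
Require Import Defs.
From Stdlib Require Import Reals List Lra Lia Psatz Classical.
From Coquelicot Require Import Coquelicot.
Open Scope R_scope.

(** * Smooth functions of two variables *)

(** The circle hypothesis speaks only of integral curves of the bisectrix field, so it says
    something at a point only once a bisectrix through that point has been constructed. This is the
    purpose of the Picard iteration.

    In the structure equations, [dq] is determined by the Gauss equation only along [e1]. The other
    component comes from [d (d tau) = 0] after division by [tau], which is nonzero because there are
    no umbilics.

    The comparison with a Lawson torus is shaped by the domain: [U] is connected in the sense of
    open sets, and closed forms on it may lack primitives. The torus parameters are therefore never
    built as functions on [U]. They are primitives of [w1] and [w2 / sqrt G] along one segment at a
    time, where [G] is the squared length of the second coordinate vector of the torus. A point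
    counts as matched when some pair of parameters works there for one fixed orthogonal matrix. That
    is all the conclusion asks, and it propagates in both directions along a segment. *)

Lemma open2_locally_2d (U P : R -> R -> Prop) (x y : R) :
  open2 U -> U x y -> (forall u v, U u v -> P u v) -> locally_2d P x y.
Proof.
  intros HU Hxy HP.
  destruct (HU x y Hxy) as [eps [Heps H]].
  exists (mkposreal eps Heps); simpl; intros u v Hu Hv.
  apply HP, H; assumption.
Qed.

Definition pd (b : bool) (g : R -> R -> R) : R -> R -> R := if b then pdx g else pdy g.
(** [true] selects the x direction, as in [pder]. The value type is arbitrary so that the predicate
    [U] restricts to a line in the same way as a function. *)
Definition slice {T : Type} (b : bool) (g : R -> R -> T) (x y : R) : R -> T :=
  if b then (fun t => g t y) else (fun t => g x t).
Definition coord (b : bool) (x y : R) : R := if b then x else y.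

Lemma pd_slice b g x y : pd b g x y = Derive (slice b g x y) (coord b x y).
Proof. destruct b; reflexivity. Qed.

Lemma slice_coord b (g : R -> R -> R) x y : slice b g x y (coord b x y) = g x y.
Proof. destruct b; reflexivity. Qed.

Lemma open2_locally_slice (U : R -> R -> Prop) (g h : R -> R -> R) x y b :
  open2 U -> U x y -> (forall u v, U u v -> g u v = h u v) ->
  locally (coord b x y) (fun t => slice b g x y t = slice b h x y t).
Proof.
  intros HU Hxy HP.
  destruct (HU x y Hxy) as [eps [Heps H]].
  exists (mkposreal eps Heps); intros t Ht.
  change (Rabs (t - coord b x y) < eps) in Ht.
  destruct b; simpl in *; apply HP, H; try assumption;
    rewrite Rminus_diag, Rabs_R0; assumption.
Qed.

Lemma pd_ext (U : R -> R -> Prop) g h x y b :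
  open2 U -> (forall u v, U u v -> g u v = h u v) -> U x y ->
  pd b g x y = pd b h x y.
Proof.
  intros HU HP Hxy. rewrite !pd_slice.
  apply Derive_ext_loc. now apply open2_locally_slice with U.
Qed.

(** Continuity is required of [g] itself; that of its partial derivatives is required one level
    higher in [Ck]. *)
Definition C1_at (g : R -> R -> R) x y : Prop :=
  (forall b, ex_derive (slice b g x y) (coord b x y)) /\ continuity_2d_pt g x y.

(** In [pder] the head of the list is the outermost derivative. Closure proofs need the opposite
    order: the product rule is applied to the innermost derivative and leaves sums of products of
    one order less. [Ck] peels off the innermost derivative, and smoothness is [Ck] for every
    order. *)
Fixpoint Ck (n : nat) (U : R -> R -> Prop) (g : R -> R -> R) : Prop :=
  (forall x y, U x y -> C1_at g x y) /\
  match n with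
  | O => True
  | S m => forall b, Ck m U (pd b g)
  end.

Lemma pder_pd ds b g : pder (ds ++ b :: nil) g = pder ds (pd b g).
Proof.
  induction ds as [|c ds IH]; simpl.
  - destruct b; reflexivity.
  - now rewrite IH.
Qed.

Lemma smooth_C1 U g x y : smooth_on U g -> U x y -> C1_at g x y.
Proof.
  intros H Hxy. destruct (H nil x y Hxy) as [H1 [H2 H3]]. simpl in *.
  split; [intros [|]|]; assumption.
Qed.

Lemma smooth_pd U g b : smooth_on U g -> smooth_on U (pd b g).
Proof.
  intros H ds. rewrite <- pder_pd. apply H.
Qed.

Lemma smooth_Ck U g : smooth_on U g -> forall n, Ck n U g.
Proof.
  intros H n. revert g H. induction n as [|n IH]; intros g H; simpl; split; auto;
    try (intros x y Hxy; now apply smooth_C1 with U).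
  intros b. apply IH. now apply smooth_pd.
Qed.

Lemma Ck_smooth U g : (forall n, Ck n U g) -> smooth_on U g.
Proof.
  intros H ds. revert g H.
  induction ds as [|b ds IH] using rev_ind; intros g H x y Hxy.
  - simpl. destruct (H O) as [H0 _]. destruct (H0 x y Hxy) as [H1 H2].
    split; [exact (H1 true)|split; [exact (H1 false)|exact H2]].
  - rewrite pder_pd. apply IH; [|assumption].
    intros n. destruct (H (S n)) as [_ H']. apply H'.
Qed.

Lemma Ck_S n U g : Ck (S n) U g -> Ck n U g.
Proof.
  revert g. induction n as [|n IH]; intros g [H1 H2]; split; auto.
Qed.

Lemma C1_at_ext (U : R -> R -> Prop) g h x y :
  open2 U -> (forall u v, U u v -> g u v = h u v) -> U x y -> C1_at g x y -> C1_at h x y.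
Proof.
  intros HU He Hxy [H1 H2]. split.
  - intros b. apply ex_derive_ext_loc with (2 := H1 b).
    now apply open2_locally_slice with U.
  - apply continuity_2d_pt_ext_loc with (2 := H2).
    apply open2_locally_2d with U; auto.
Qed.

Lemma Ck_ext n (U : R -> R -> Prop) g h :
  open2 U -> (forall u v, U u v -> g u v = h u v) -> Ck n U g -> Ck n U h.
Proof.
  intros HU. revert g h. induction n as [|n IH]; intros g h He [H1 H2]; split; auto;
    try (intros; apply C1_at_ext with U g; auto).
  intros b. apply IH with (pd b g); auto.
  intros u v Huv. now apply pd_ext with U.
Qed.

Lemma smooth_ext U g h :
  open2 U -> (forall u v, U u v -> g u v = h u v) -> smooth_on U g -> smooth_on U h.
Proof.
  intros HU He H. apply Ck_smooth. intros n. apply Ck_ext with g; auto.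
  now apply smooth_Ck.
Qed.

Lemma C1_pd g x y b : C1_at g x y -> is_derive (slice b g x y) (coord b x y) (pd b g x y).
Proof.
  intros [H _]. rewrite pd_slice. apply Derive_correct, H.
Qed.

Lemma slice_plus b g h x y :
  slice b (fun u v => g u v + h u v) x y = fun t => slice b g x y t + slice b h x y t.
Proof. destruct b; reflexivity. Qed.

Lemma slice_mult b g h x y :
  slice b (fun u v => g u v * h u v) x y = fun t => slice b g x y t * slice b h x y t.
Proof. destruct b; reflexivity. Qed.

Lemma C1_pd_plus b g h x y : C1_at g x y -> C1_at h x y ->
  is_derive (slice b (fun u v => g u v + h u v) x y) (coord b x y)
    (pd b g x y + pd b h x y).
Proof.
  intros Hg Hh. rewrite slice_plus.
  apply (is_derive_plus (slice b g x y) (slice b h x y)); now apply C1_pd.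
Qed.

Lemma C1_pd_mult b g h x y : C1_at g x y -> C1_at h x y ->
  is_derive (slice b (fun u v => g u v * h u v) x y) (coord b x y)
    (pd b g x y * h x y + g x y * pd b h x y).
Proof.
  intros Hg Hh. rewrite slice_mult.
  assert (H := is_derive_mult (slice b g x y) (slice b h x y) _ _ _
    (C1_pd g x y b Hg) (C1_pd h x y b Hh) Rmult_comm).
  rewrite !slice_coord in H. exact H.
Qed.

Lemma C1_plus g h x y : C1_at g x y -> C1_at h x y -> C1_at (fun u v => g u v + h u v) x y.
Proof.
  intros Hg Hh. split.
  - intros b. eexists. now apply C1_pd_plus.
  - apply continuity_2d_pt_plus; [apply Hg | apply Hh].
Qed.

Lemma C1_mult g h x y : C1_at g x y -> C1_at h x y -> C1_at (fun u v => g u v * h u v) x y.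
Proof.
  intros Hg Hh. split.
  - intros b. eexists. now apply C1_pd_mult.
  - apply continuity_2d_pt_mult; [apply Hg | apply Hh].
Qed.

Lemma C1_const c x y : C1_at (fun _ _ => c) x y.
Proof.
  split.
  - intros [|]; apply ex_derive_const.
  - apply continuity_2d_pt_const.
Qed.

Lemma pd_const b c x y : pd b (fun _ _ => c) x y = 0.
Proof. destruct b; exact (Derive_const c _). Qed.

Lemma Ck_const n U c : Ck n U (fun _ _ => c).
Proof.
  revert c. induction n as [|n IH]; intros c; split; auto; try (intros; apply C1_const).
  intros b.
  replace (pd b (fun _ _ => c)) with (fun _ _ : R => 0).
  - apply IH.
  - destruct b; unfold pd, pdx, pdy;
      do 2 (apply FunctionalExtensionality.functional_extensionality; intro);
      now rewrite Derive_const.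
Qed.

Lemma Ck_C1 n U g x y : Ck n U g -> U x y -> C1_at g x y.
Proof. destruct n; intros [H _]; apply H. Qed.

Lemma Ck_plus n U g h : open2 U -> Ck n U g -> Ck n U h -> Ck n U (fun u v => g u v + h u v).
Proof.
  intros HU. revert g h. induction n as [|n IH]; intros g h [Hg Hg'] [Hh Hh']; split; auto;
    try (intros x y Hxy; apply C1_plus; auto).
  intros b. apply Ck_ext with (fun u v => pd b g u v + pd b h u v); auto.
  intros u v Huv. symmetry. rewrite (pd_slice b (fun u v => g u v + h u v)).
  apply is_derive_unique, C1_pd_plus; auto.
Qed.

Lemma Ck_mult n U g h : open2 U -> Ck n U g -> Ck n U h -> Ck n U (fun u v => g u v * h u v).
Proof.
  intros HU. revert g h. induction n as [|n IH]; intros g h Hg Hh.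
  - split; auto. intros x y Hxy; apply C1_mult; eapply Ck_C1; eauto.
  - split; [intros x y Hxy; apply C1_mult; eapply Ck_C1; eauto|].
    intros b.
    apply Ck_ext with (fun u v => pd b g u v * h u v + g u v * pd b h u v); auto.
    + intros u v Huv. symmetry. rewrite (pd_slice b (fun u v => g u v * h u v)).
      apply is_derive_unique, C1_pd_mult; eapply Ck_C1; eauto.
    + apply Ck_plus; auto; apply IH; try (now apply Ck_S); [apply Hg | apply Hh].
Qed.

Lemma smooth_const U c : smooth_on U (fun _ _ => c).
Proof. apply Ck_smooth; intros; apply Ck_const. Qed.

Lemma smooth_plus U g h : open2 U -> smooth_on U g -> smooth_on U h ->
  smooth_on U (fun u v => g u v + h u v).
Proof. intros; apply Ck_smooth; intros; apply Ck_plus; auto; now apply smooth_Ck. Qed.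

Lemma smooth_mult U g h : open2 U -> smooth_on U g -> smooth_on U h ->
  smooth_on U (fun u v => g u v * h u v).
Proof. intros; apply Ck_smooth; intros; apply Ck_mult; auto; now apply smooth_Ck. Qed.

Lemma smooth_opp U g : open2 U -> smooth_on U g -> smooth_on U (fun u v => - g u v).
Proof.
  intros HU Hg. apply smooth_ext with (fun u v => (-1) * g u v); auto.
  - intros; ring.
  - apply (smooth_mult U (fun _ _ => -1)); auto. apply smooth_const.
Qed.

Lemma smooth_minus U g h : open2 U -> smooth_on U g -> smooth_on U h ->
  smooth_on U (fun u v => g u v - h u v).
Proof.
  intros. apply (smooth_plus U g (fun u v => - h u v)); auto. now apply smooth_opp.
Qed.

Lemma slice_comp b (phi : R -> R) g x y :
  slice b (fun u v => phi (g u v)) x y = fun t => phi (slice b g x y t).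
Proof. destruct b; reflexivity. Qed.

Lemma is_derive_inv_sqrt D : 0 < D ->
  is_derive (fun t => / sqrt t) D (- / 2 * (/ sqrt D * / sqrt D * / sqrt D)).
Proof.
  intros HD. assert (Hs := sqrt_lt_R0 _ HD).
  auto_derive; [split; [exact HD | split; [lra | exact I]]|].
  field. lra.
Qed.

Lemma C1_pd_inv_sqrt b D x y : C1_at D x y -> 0 < D x y ->
  is_derive (slice b (fun u v => / sqrt (D u v)) x y) (coord b x y)
    (- / 2 * pd b D x y * (/ sqrt (D x y) * / sqrt (D x y) * / sqrt (D x y))).
Proof.
  intros HC HD. rewrite (slice_comp b (fun t => / sqrt t)).
  assert (H1 := C1_pd D x y b HC).
  assert (H2 := is_derive_inv_sqrt (D x y) HD).
  rewrite <- (slice_coord b D x y) in H2 at 1.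
  assert (H3 := is_derive_comp (fun t => / sqrt t) (slice b D x y) _ _ _ H2 H1).
  match type of H3 with is_derive _ _ ?l =>
    match goal with |- is_derive _ _ ?l' => replace l' with l; [exact H3|] end end.
  unfold scal; simpl; unfold mult; simpl. ring.
Qed.

Lemma C1_inv_sqrt D x y : C1_at D x y -> 0 < D x y -> C1_at (fun u v => / sqrt (D u v)) x y.
Proof.
  intros HC HD. split.
  - intros b. eexists. now apply C1_pd_inv_sqrt.
  - apply (continuity_1d_2d_pt_comp (fun t => / sqrt t)); [|apply HC].
    apply continuity_pt_filterlim.
    apply (ex_derive_continuous (fun t => / sqrt t)).
    eexists. now apply is_derive_inv_sqrt.
Qed.

(** With [h = 1 / sqrt D] one has [h' = - D' h^3 / 2], a polynomial in [h] and [D'], so the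
    induction on the order closes on [h] itself. *)
Lemma smooth_inv_sqrt U D : open2 U -> smooth_on U D -> (forall x y, U x y -> 0 < D x y) ->
  smooth_on U (fun u v => / sqrt (D u v)).
Proof.
  intros HU HD Hpos. apply Ck_smooth. intros n.
  assert (HC : forall x y, U x y -> C1_at (fun u v => / sqrt (D u v)) x y).
  { intros x y Hxy. apply C1_inv_sqrt; auto. now apply smooth_C1 with U. }
  induction n as [|n IH]; split; auto.
  intros b.
  apply Ck_ext with (fun u v => - / 2 * pd b D u v *
     (/ sqrt (D u v) * / sqrt (D u v) * / sqrt (D u v))); auto.
  - intros u v Huv. symmetry. rewrite (pd_slice b (fun u v => / sqrt (D u v))).
    apply is_derive_unique, C1_pd_inv_sqrt; auto. now apply smooth_C1 with U.
  - apply (Ck_mult n U (fun u v => - / 2 * pd b D u v)); auto.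
    + apply (Ck_mult n U (fun _ _ => - / 2)); auto.
      * apply Ck_const.
      * now apply smooth_Ck, smooth_pd.
    + apply (Ck_mult n U (fun u v => / sqrt (D u v) * / sqrt (D u v))); auto.
      apply Ck_mult; auto.
Qed.

Lemma pd_plus U b g h x y : smooth_on U g -> smooth_on U h -> U x y ->
  pd b (fun u v => g u v + h u v) x y = pd b g x y + pd b h x y.
Proof.
  intros. rewrite (pd_slice b (fun u v => g u v + h u v)).
  apply is_derive_unique, C1_pd_plus; eapply smooth_C1; eauto.
Qed.

Lemma pd_mult U b g h x y : smooth_on U g -> smooth_on U h -> U x y ->
  pd b (fun u v => g u v * h u v) x y = pd b g x y * h x y + g x y * pd b h x y.
Proof.
  intros. rewrite (pd_slice b (fun u v => g u v * h u v)).
  apply is_derive_unique, C1_pd_mult; eapply smooth_C1; eauto.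
Qed.

Lemma pd_comm U b c g x y : open2 U -> smooth_on U g -> U x y ->
  pd b (pd c g) x y = pd c (pd b g) x y.
Proof.
  intros HU Hg Hxy.
  assert (H : pd true (pd false g) x y = pd false (pd true g) x y).
  { apply Schwarz.
    - apply open2_locally_2d with U; auto. intros u v Huv.
      destruct (smooth_C1 U g u v Hg Huv) as [H1 _].
      destruct (smooth_C1 U (pd false g) u v (smooth_pd U g false Hg) Huv) as [H2 _].
      destruct (smooth_C1 U (pd true g) u v (smooth_pd U g true Hg) Huv) as [H3 _].
      split; [exact (H1 true)|split; [exact (H1 false)|split]].
      + exact (H2 true).
      + exact (H3 false).
    - apply (smooth_C1 U (pd true (pd false g)) x y); auto. now do 2 apply smooth_pd.
    - apply (smooth_C1 U (pd false (pd true g)) x y); auto. now do 2 apply smooth_pd. }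
  destruct b, c; auto.
Qed.

Lemma smooth_differentiable U g x y : open2 U -> smooth_on U g -> U x y ->
  differentiable_pt_lim g x y (pdx g x y) (pdy g x y).
Proof.
  intros HU Hg Hxy. apply filterdiff_differentiable_pt_lim.
  destruct (HU x y Hxy) as [eps [Heps H]].
  apply is_derive_filterdiff with (dfx := pdx g).
  - exists (mkposreal eps Heps). intros [u v] [Hu Hv].
    apply (C1_pd g u v true), smooth_C1 with U; auto.
  - apply (C1_pd g x y false), smooth_C1 with U; auto.
  - apply continuity_2d_pt_filterlim with (f := pdx g).
    apply (smooth_C1 U (pd true g) x y); auto. now apply (smooth_pd U g true).
Qed.

Lemma smooth_curve U g c1 c2 s l1 l2 : open2 U -> smooth_on U g -> U (c1 s) (c2 s) ->
  is_derive c1 s l1 -> is_derive c2 s l2 ->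
  is_derive (fun t => g (c1 t) (c2 t)) s
    (pdx g (c1 s) (c2 s) * l1 + pdy g (c1 s) (c2 s) * l2).
Proof.
  intros HU Hg Hc H1 H2. apply is_derive_Reals, derivable_pt_lim_comp_2d.
  - now apply smooth_differentiable with U.
  - now apply is_derive_Reals.
  - now apply is_derive_Reals.
Qed.

Lemma smooth_slice (U : R -> R -> Prop) b g x y t : smooth_on U g -> slice b U x y t ->
  is_derive (slice b g x y) t (slice b (pd b g) x y t).
Proof.
  intros Hg Ht. destruct b; simpl in Ht.
  - exact (C1_pd g t y true (smooth_C1 U g t y Hg Ht)).
  - exact (C1_pd g x t false (smooth_C1 U g x t Hg Ht)).
Qed.

Lemma smooth_slice_continuous (U : R -> R -> Prop) b g x y t : smooth_on U g -> slice b U x y t ->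
  continuous (slice b g x y) t.
Proof.
  intros Hg Ht. apply (ex_derive_continuous (slice b g x y)).
  eexists. now apply smooth_slice with U.
Qed.

(** * Local existence of integral curves *)

Lemma is_lim_seq_geom_half K : is_lim_seq (fun n => K * (/ 2) ^ n) 0.
Proof.
  replace (Finite 0) with (Rbar_mult K 0) by (simpl; f_equal; ring).
  apply is_lim_seq_scal_l, is_lim_seq_geom. rewrite Rabs_pos_eq; lra.
Qed.

Lemma le_of_geometric x K : (forall n, x <= K * (/ 2) ^ n) -> x <= 0.
Proof.
  intros H.
  exact (is_lim_seq_le (fun _ => x) _ x 0 H (is_lim_seq_const x) (is_lim_seq_geom_half K)).
Qed.

(** The sequence [u n - 2 K / 2^n] increases and [u n + 2 K / 2^n] decreases. The supremum of the
    first lies between the two, hence is the limit, and the gap is the explicit rate. *)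
Lemma geometric_cauchy (u : nat -> R) K :
  (forall n, Rabs (u (S n) - u n) <= K * (/ 2) ^ n) ->
  forall n, Rabs (u n - real (Lim_seq u)) <= 2 * K * (/ 2) ^ n.
Proof.
  intros H.
  assert (HK : 0 <= K).
  { specialize (H O). simpl in H. assert (Hp := Rabs_pos (u 1%nat - u 0%nat)). lra. }
  assert (Hpow : forall n, 0 < (/ 2) ^ n) by (intros; apply pow_lt; lra).
  assert (Hw : forall n k, u n - 2 * K * (/ 2) ^ n <= u (n + k)%nat - 2 * K * (/ 2) ^ (n + k)).
  { intros n k. induction k as [|k IH]; [rewrite Nat.add_0_r; lra|].
    rewrite Nat.add_succ_r. specialize (H (n + k)%nat). apply Rabs_le_between in H.
    simpl pow. lra. }
  assert (Hv : forall n k, u (n + k)%nat + 2 * K * (/ 2) ^ (n + k) <= u n + 2 * K * (/ 2) ^ n).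
  { intros n k. induction k as [|k IH]; [rewrite Nat.add_0_r; lra|].
    rewrite Nat.add_succ_r. specialize (H (n + k)%nat). apply Rabs_le_between in H.
    simpl pow. lra. }
  assert (Hwv : forall m n, u m - 2 * K * (/ 2) ^ m <= u n + 2 * K * (/ 2) ^ n).
  { intros m n. destruct (Nat.le_ge_cases m n) as [Hmn|Hmn].
    - specialize (Hw m (n - m)%nat). replace (m + (n - m))%nat with n in Hw by lia.
      specialize (Hpow n). nra.
    - specialize (Hv n (m - n)%nat). replace (n + (m - n))%nat with m in Hv by lia.
      specialize (Hpow m). nra. }
  destruct (completeness (fun x => exists m, x = u m - 2 * K * (/ 2) ^ m)) as [l [Hl1 Hl2]].
  { exists (u 0%nat + 2 * K * (/ 2) ^ 0). intros x [m ->]. apply Hwv. }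
  { eexists; exists 0%nat; reflexivity. }
  assert (Hl : forall n, Rabs (u n - l) <= 2 * K * (/ 2) ^ n).
  { intros n. apply Rabs_le_between. split.
    - assert (l <= u n + 2 * K * (/ 2) ^ n); [|lra].
      apply Hl2. intros x [m ->]. apply Hwv.
    - assert (u n - 2 * K * (/ 2) ^ n <= l); [|lra].
      apply Hl1. now exists n. }
  assert (Hlim : is_lim_seq u l).
  { apply is_lim_seq_le_le with (u := fun n => l - 2 * K * (/ 2) ^ n)
      (w := fun n => l + 2 * K * (/ 2) ^ n).
    - intros n. specialize (Hl n). apply Rabs_le_between in Hl. lra.
    - replace (Finite l) with (Finite (l - 0)) by (f_equal; ring).
      apply is_lim_seq_minus'; [apply is_lim_seq_const | apply is_lim_seq_geom_half].
    - replace (Finite l) with (Finite (l + 0)) by (f_equal; ring).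
      apply is_lim_seq_plus'; [apply is_lim_seq_const | apply is_lim_seq_geom_half]. }
  rewrite (is_lim_seq_unique _ _ Hlim). exact Hl.
Qed.

Lemma abs_RInt_bound f a b M :
  ex_RInt f a b -> (forall t, Rmin a b <= t <= Rmax a b -> Rabs (f t) <= M) ->
  Rabs (RInt f a b) <= M * Rabs (b - a).
Proof.
  intros Hf HM. destruct (Rle_lt_dec a b) as [Hab|Hab].
  - rewrite (Rabs_pos_eq (b - a)), Rmult_comm by lra.
    rewrite Rmin_left, Rmax_right in HM by lra.
    now apply abs_RInt_le_const.
  - rewrite (Rabs_left1 (b - a)) by lra.
    rewrite Rmin_right, Rmax_left in HM by lra.
    rewrite <- opp_RInt_swap by now apply ex_RInt_swap.
    change (Rabs (- RInt f b a) <= M * - (b - a)).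
    rewrite Rabs_Ropp. replace (M * - (b - a)) with ((a - b) * M) by ring.
    apply abs_RInt_le_const; [lra | now apply ex_RInt_swap | assumption].
Qed.

Lemma lipschitz_continuous (f : R -> R) K x eps : 0 < eps ->
  (forall y, Rabs (y - x) < eps -> Rabs (f y - f x) <= K * Rabs (y - x)) -> continuous f x.
Proof.
  intros Heps H. apply continuity_pt_filterlim. intros e He.
  exists (Rmin eps (e / (Rabs K + 1))).
  assert (HK := Rabs_pos K). assert (HK' := Rle_abs K).
  assert (0 < e / (Rabs K + 1)) by (apply Rdiv_lt_0_compat; lra).
  split; [now apply Rmin_glb_lt|].
  intros y [_ Hy]. simpl in *. unfold R_dist in *.
  assert (Hy1 := Rlt_le_trans _ _ _ Hy (Rmin_l _ _)).
  assert (Hy2 := Rlt_le_trans _ _ _ Hy (Rmin_r _ _)).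
  apply Rle_lt_trans with (1 := H y Hy1).
  apply Rle_lt_trans with ((Rabs K + 1) * Rabs (y - x)).
  - apply Rmult_le_compat_r; [apply Rabs_pos | lra].
  - apply (Rmult_lt_compat_l (Rabs K + 1)) in Hy2; [|lra].
    replace ((Rabs K + 1) * (e / (Rabs K + 1))) with e in Hy2 by (field; lra). lra.
Qed.

Definition lip2 (L : R) (P : R -> R -> R) : Prop :=
  forall x y x' y', Rabs (P x y - P x' y') <= L * (Rabs (x - x') + Rabs (y - y')).

Lemma lip2_comp_continuous L P (c d : R -> R) s : 0 <= L -> lip2 L P ->
  continuous c s -> continuous d s -> continuous (fun t => P (c t) (d t)) s.
Proof.
  intros HL HP Hc Hd.
  apply continuity_pt_filterlim in Hc. apply continuity_pt_filterlim in Hd.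
  apply continuity_pt_filterlim. intros e He.
  assert (He' : 0 < e / (2 * (L + 1))) by (apply Rdiv_lt_0_compat; lra).
  destruct (Hc _ He') as [d1 [Hd1 H1]]. destruct (Hd _ He') as [d2 [Hd2 H2]].
  exists (Rmin d1 d2). split; [now apply Rmin_glb_lt|].
  intros t [HD Ht]. simpl in *. unfold R_dist in *.
  assert (Ht1 := Rlt_le_trans _ _ _ Ht (Rmin_l _ _)).
  assert (Ht2 := Rlt_le_trans _ _ _ Ht (Rmin_r _ _)).
  specialize (H1 t (conj HD Ht1)). specialize (H2 t (conj HD Ht2)).
  apply Rle_lt_trans with (1 := HP _ _ _ _).
  apply Rle_lt_trans with ((L + 1) * (Rabs (c t - c s) + Rabs (d t - d s))).
  - apply Rmult_le_compat_r; [|lra].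
    assert (Hp := Rabs_pos (c t - c s)). assert (Hq := Rabs_pos (d t - d s)). lra.
  - apply Rlt_le_trans with ((L + 1) * (e / (2 * (L + 1)) + e / (2 * (L + 1)))).
    + apply Rmult_lt_compat_l; lra.
    + right; field; lra.
Qed.

(** * Picard iteration for a bounded, globally Lipschitz planar field *)

Section Picard.
Variables (P Q : R -> R -> R) (L M x0 y0 h : R).
Hypotheses (HL : 0 <= L) (HP : lip2 L P) (HQ : lip2 L Q).
Hypotheses (HMP : forall x y, Rabs (P x y) <= M) (HMQ : forall x y, Rabs (Q x y) <= M).
Hypotheses (Hh : 0 < h) (HLh : 4 * L * h <= 1).

Fixpoint picard (n : nat) : (R -> R) * (R -> R) :=
  match n with
  | O => (fun _ => x0, fun _ => y0)
  | S m => let c := picard m in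
      (fun s => x0 + RInt (fun t => P (fst c t) (snd c t)) 0 s,
       fun s => y0 + RInt (fun t => Q (fst c t) (snd c t)) 0 s)
  end.

Lemma ex_RInt_everywhere_continuous (f : R -> R) a b :
  (forall s, continuous f s) -> ex_RInt f a b.
Proof. intros H. apply (ex_RInt_continuous f). intros; apply H. Qed.

Lemma continuous_primitive (f : R -> R) z s :
  (forall s, continuous f s) -> continuous (fun s => z + RInt f 0 s) s.
Proof.
  intros H. apply (ex_derive_continuous (fun s => z + RInt f 0 s)).
  exists (0 + f s). apply (is_derive_plus (fun _ => z)).
  - apply (is_derive_const z).
  - apply (is_derive_RInt f (RInt f 0) 0 s); [|apply H].
    exists (mkposreal 1 Rlt_0_1). intros t _. apply (RInt_correct f).
    now apply ex_RInt_everywhere_continuous.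
Qed.

Lemma picard_continuous n s : continuous (fst (picard n)) s /\ continuous (snd (picard n)) s.
Proof.
  revert s. induction n as [|n IH]; intros s; simpl.
  - split; apply continuous_const.
  - split; apply continuous_primitive; intros t;
      apply lip2_comp_continuous with L; auto; apply IH.
Qed.

Lemma picard_field_continuous R n s : lip2 L R ->
  continuous (fun t => R (fst (picard n) t) (snd (picard n) t)) s.
Proof. intros HR. apply lip2_comp_continuous with L; auto; apply picard_continuous. Qed.

(** The contraction estimate: each of the two components costs a factor [L h <= 1/4], so the sum of
    both differences is halved at every iteration. *)
Lemma picard_integral_diff R n s K : lip2 L R -> Rabs s <= h ->
  (forall t, Rabs t <= h -> Rabs (fst (picard (S n)) t - fst (picard n) t)
                          + Rabs (snd (picard (S n)) t - snd (picard n) t) <= K) ->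
  Rabs (RInt (fun t => R (fst (picard (S n)) t) (snd (picard (S n)) t)) 0 s
        - RInt (fun t => R (fst (picard n) t) (snd (picard n) t)) 0 s) <= K / 4.
Proof.
  intros HR Hs HK.
  assert (HK0 : 0 <= K).
  { specialize (HK s Hs).
    assert (Hp := Rabs_pos (fst (picard (S n)) s - fst (picard n) s)).
    assert (Hq := Rabs_pos (snd (picard (S n)) s - snd (picard n) s)). lra. }
  set (f := fun t => R (fst (picard (S n)) t) (snd (picard (S n)) t)).
  set (g := fun t => R (fst (picard n) t) (snd (picard n) t)).
  assert (Hf : ex_RInt f 0 s) by
    (apply ex_RInt_everywhere_continuous; intros; now apply picard_field_continuous).
  assert (Hg : ex_RInt g 0 s) by
    (apply ex_RInt_everywhere_continuous; intros; now apply picard_field_continuous).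
  change (Rabs (minus (RInt f 0 s) (RInt g 0 s)) <= K / 4).
  rewrite <- RInt_minus by assumption.
  apply Rle_trans with ((L * K) * Rabs (s - 0)).
  - apply abs_RInt_bound; [now apply (ex_RInt_minus f g)|].
    intros t Ht. apply Rle_trans with (1 := HR _ _ _ _).
    apply Rmult_le_compat_l; auto. apply HK.
    apply Rabs_le_between in Hs. apply Rabs_le_between.
    unfold Rmin, Rmax in Ht. destruct (Rle_dec 0 s); lra.
  - rewrite Rminus_0_r. apply Rle_trans with (L * K * h).
    + apply Rmult_le_compat_l; [now apply Rmult_le_pos | assumption].
    + nra.
Qed.

Lemma picard_step n s : Rabs s <= h ->
  Rabs (fst (picard (S n)) s - fst (picard n) s)
  + Rabs (snd (picard (S n)) s - snd (picard n) s) <= 2 * M * h * (/ 2) ^ n.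
Proof.
  revert s. induction n as [|n IH]; intros s Hs.
  - simpl. rewrite Rmult_1_r.
    replace (x0 + RInt (fun _ => P x0 y0) 0 s - x0) with (s * P x0 y0)
      by (rewrite RInt_const; unfold scal; simpl; unfold mult; simpl; ring).
    replace (y0 + RInt (fun _ => Q x0 y0) 0 s - y0) with (s * Q x0 y0)
      by (rewrite RInt_const; unfold scal; simpl; unfold mult; simpl; ring).
    rewrite !Rabs_mult.
    assert (H1 := Rmult_le_compat _ _ _ _ (Rabs_pos s) (Rabs_pos _) Hs (HMP x0 y0)).
    assert (H2 := Rmult_le_compat _ _ _ _ (Rabs_pos s) (Rabs_pos _) Hs (HMQ x0 y0)).
    lra.
  - assert (H1 := picard_integral_diff P n s _ HP Hs IH).
    assert (H2 := picard_integral_diff Q n s _ HQ Hs IH).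
    simpl pow.
    change (fst (picard (S (S n))) s) with
      (x0 + RInt (fun t => P (fst (picard (S n)) t) (snd (picard (S n)) t)) 0 s).
    change (snd (picard (S (S n))) s) with
      (y0 + RInt (fun t => Q (fst (picard (S n)) t) (snd (picard (S n)) t)) 0 s).
    change (fst (picard (S n)) s) with
      (x0 + RInt (fun t => P (fst (picard n) t) (snd (picard n) t)) 0 s).
    change (snd (picard (S n)) s) with
      (y0 + RInt (fun t => Q (fst (picard n) t) (snd (picard n) t)) 0 s).
    match goal with |- Rabs ?p + Rabs ?q <= _ =>
      match type of H1 with Rabs ?p' <= _ => replace p with p' by ring end;
      match type of H2 with Rabs ?q' <= _ => replace q with q' by ring end
    end.
    lra.
Qed.

(** Convergence is controlled only for [|s| <= h]; elsewhere [Lim_seq] returns a value without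
    meaning. *)
Definition flow1 (s : R) : R := real (Lim_seq (fun n => fst (picard n) s)).
Definition flow2 (s : R) : R := real (Lim_seq (fun n => snd (picard n) s)).

Lemma flow_approx n s : Rabs s <= h ->
  Rabs (fst (picard n) s - flow1 s) <= 4 * M * h * (/ 2) ^ n /\
  Rabs (snd (picard n) s - flow2 s) <= 4 * M * h * (/ 2) ^ n.
Proof.
  intros Hs. replace (4 * M * h) with (2 * (2 * M * h)) by ring.
  split.
  - apply (geometric_cauchy (fun n => fst (picard n) s)). intros m.
    assert (H := picard_step m s Hs).
    assert (Hq := Rabs_pos (snd (picard (S m)) s - snd (picard m) s)). lra.
  - apply (geometric_cauchy (fun n => snd (picard n) s)). intros m.
    assert (H := picard_step m s Hs).
    assert (Hq := Rabs_pos (fst (picard (S m)) s - fst (picard m) s)). lra.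
Qed.

Lemma picard_lipschitz n s t :
  Rabs (fst (picard n) t - fst (picard n) s) <= M * Rabs (t - s) /\
  Rabs (snd (picard n) t - snd (picard n) s) <= M * Rabs (t - s).
Proof.
  assert (HM : 0 <= M) by (assert (H := HMP 0 0); assert (H' := Rabs_pos (P 0 0)); lra).
  assert (HA := Rabs_pos (t - s)).
  destruct n as [|n]; simpl.
  - rewrite !Rminus_diag, Rabs_R0. split; nra.
  - assert (Hgen : forall R z, lip2 L R -> (forall x y, Rabs (R x y) <= M) ->
      Rabs (z + RInt (fun u => R (fst (picard n) u) (snd (picard n) u)) 0 t
            - (z + RInt (fun u => R (fst (picard n) u) (snd (picard n) u)) 0 s))
      <= M * Rabs (t - s)).
    { intros R z HR HMR.
      set (f := fun u => R (fst (picard n) u) (snd (picard n) u)).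
      assert (Hf : forall a b, ex_RInt f a b) by
        (intros; apply ex_RInt_everywhere_continuous; intros; now apply picard_field_continuous).
      replace (z + RInt f 0 t - (z + RInt f 0 s)) with (RInt f s t).
      - apply abs_RInt_bound; auto. intros; apply HMR.
      - assert (H := RInt_Chasles f 0 s t (Hf _ _) (Hf _ _)).
        unfold plus in H; simpl in H. lra. }
    split; apply Hgen; auto.
Qed.

Lemma flow_lipschitz s t : Rabs s <= h -> Rabs t <= h ->
  Rabs (flow1 t - flow1 s) <= M * Rabs (t - s) /\
  Rabs (flow2 t - flow2 s) <= M * Rabs (t - s).
Proof.
  intros Hs Ht.
  split; apply Rminus_le; apply le_of_geometric with (8 * M * h); intros n;
    destruct (flow_approx n s Hs) as [H1 H2]; destruct (flow_approx n t Ht) as [H3 H4];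
    destruct (picard_lipschitz n s t) as [H5 H6].
  - apply Rabs_le_between in H1. apply Rabs_le_between in H3. apply Rabs_le_between in H5.
    assert (Rabs (flow1 t - flow1 s) <= M * Rabs (t - s) + 8 * M * h * (/ 2) ^ n); [|lra].
    apply Rabs_le_between. lra.
  - apply Rabs_le_between in H2. apply Rabs_le_between in H4. apply Rabs_le_between in H6.
    assert (Rabs (flow2 t - flow2 s) <= M * Rabs (t - s) + 8 * M * h * (/ 2) ^ n); [|lra].
    apply Rabs_le_between. lra.
Qed.

Lemma flow_continuous s : Rabs s < h -> continuous flow1 s /\ continuous flow2 s.
Proof.
  intros Hs.
  split; apply lipschitz_continuous with M (h - Rabs s); try lra; intros t Ht;
    apply flow_lipschitz; try lra;
    assert (H := Rabs_triang (t - s) s); replace (t - s + s) with t in H by ring; lra.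
Qed.

Lemma flow_field_continuous R s : lip2 L R -> Rabs s < h ->
  continuous (fun t => R (flow1 t) (flow2 t)) s.
Proof.
  intros HR Hs. apply lip2_comp_continuous with L; auto; now apply flow_continuous.
Qed.

Lemma flow_field_ex_RInt R s : lip2 L R -> Rabs s < h ->
  ex_RInt (fun t => R (flow1 t) (flow2 t)) 0 s.
Proof.
  intros HR Hs. apply (ex_RInt_continuous (fun t => R (flow1 t) (flow2 t))).
  intros t Ht. apply flow_field_continuous; auto.
  apply Rabs_lt_between in Hs. apply Rabs_lt_between.
  unfold Rmin, Rmax in Ht. destruct (Rle_dec 0 s); lra.
Qed.

Lemma flow_field_approx R n s : lip2 L R -> Rabs s < h ->
  Rabs (RInt (fun t => R (fst (picard n) t) (snd (picard n) t)) 0 s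
        - RInt (fun t => R (flow1 t) (flow2 t)) 0 s) <= 2 * M * h * (/ 2) ^ n.
Proof.
  intros HR Hs.
  set (f := fun t => R (fst (picard n) t) (snd (picard n) t)).
  set (g := fun t => R (flow1 t) (flow2 t)).
  assert (Hf : ex_RInt f 0 s) by
    (apply ex_RInt_everywhere_continuous; intros; now apply picard_field_continuous).
  assert (Hg : ex_RInt g 0 s) by now apply flow_field_ex_RInt.
  assert (HM : 0 <= M) by (assert (H := HMP 0 0); assert (H' := Rabs_pos (P 0 0)); lra).
  assert (Hpow : 0 <= (/ 2) ^ n) by (apply pow_le; lra).
  assert (HMh : 0 <= M * h * (/ 2) ^ n) by (repeat apply Rmult_le_pos; lra).
  change (Rabs (minus (RInt f 0 s) (RInt g 0 s)) <= 2 * M * h * (/ 2) ^ n).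
  rewrite <- RInt_minus by assumption.
  (* Two components, each within [4 M h / 2^n] of its limit, give the 8; the remaining [L h] is
     absorbed by [4 L h <= 1]. *)
  apply Rle_trans with (L * (8 * M * h * (/ 2) ^ n) * Rabs (s - 0)).
  - apply abs_RInt_bound; [now apply (ex_RInt_minus f g)|].
    intros t Ht. apply Rle_trans with (1 := HR _ _ _ _).
    apply Rmult_le_compat_l; auto.
    assert (Ht' : Rabs t <= h).
    { apply Rabs_lt_between in Hs. apply Rabs_le_between.
      unfold Rmin, Rmax in Ht. destruct (Rle_dec 0 s); lra. }
    destruct (flow_approx n t Ht'). lra.
  - rewrite Rminus_0_r.
    apply Rle_trans with (L * (8 * M * h * (/ 2) ^ n) * h).
    + apply Rmult_le_compat_l; [apply Rmult_le_pos; lra | lra].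
    + nra.
Qed.

(** Limit of the Picard recursion. The iterate with index [S n] and the integral with index [n] are
    each within [2 M h / 2^n] of their limits, so the two sides differ by at most [4 M h / 2^n] for
    every [n]. *)
Lemma flow_integral s : Rabs s < h ->
  flow1 s = x0 + RInt (fun t => P (flow1 t) (flow2 t)) 0 s /\
  flow2 s = y0 + RInt (fun t => Q (flow1 t) (flow2 t)) 0 s.
Proof.
  intros Hs.
  assert (Hpow : forall n, 0 <= (/ 2) ^ n) by (intros; apply pow_le; lra).
  split; apply Rminus_diag_uniq; apply Rabs_eq_0, Rle_antisym; try apply Rabs_pos;
    apply le_of_geometric with (4 * M * h); intros n;
    destruct (flow_approx (S n) s (Rlt_le _ _ Hs)) as [H1 H2]; simpl pow in H1, H2.
  - assert (H3 := flow_field_approx P n s HP Hs).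
    change (fst (picard (S n)) s) with
      (x0 + RInt (fun t => P (fst (picard n) t) (snd (picard n) t)) 0 s) in H1.
    apply Rabs_le_between in H1. apply Rabs_le_between in H3. apply Rabs_le_between. lra.
  - assert (H3 := flow_field_approx Q n s HQ Hs).
    change (snd (picard (S n)) s) with
      (y0 + RInt (fun t => Q (fst (picard n) t) (snd (picard n) t)) 0 s) in H2.
    apply Rabs_le_between in H2. apply Rabs_le_between in H3. apply Rabs_le_between. lra.
Qed.

Lemma flow_derive s : Rabs s < h ->
  is_derive flow1 s (P (flow1 s) (flow2 s)) /\ is_derive flow2 s (Q (flow1 s) (flow2 s)).
Proof.
  intros Hs.
  assert (Hloc : locally s (fun t => Rabs t < h)).
  { assert (Hd : 0 < h - Rabs s) by lra.
    assert (Hb : forall t : R, Rabs (t - s) < h - Rabs s -> Rabs t < h).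
    { intros t Ht. assert (H := Rabs_triang (t - s) s).
      replace (t - s + s) with t in H by ring. lra. }
    exists (mkposreal _ Hd). exact Hb. }
  assert (Hgen : forall R z, lip2 L R ->
    is_derive (fun s => z + RInt (fun t => R (flow1 t) (flow2 t)) 0 s) s
      (R (flow1 s) (flow2 s))).
  { intros R z HR. rewrite <- (Rplus_0_l (R (flow1 s) (flow2 s))).
    apply (is_derive_plus (fun _ => z)); [apply (is_derive_const z)|].
    apply (is_derive_RInt (fun t => R (flow1 t) (flow2 t))
             (RInt (fun t => R (flow1 t) (flow2 t)) 0) 0 s).
    - apply filter_imp with (2 := Hloc). intros t Ht.
      apply (RInt_correct (fun t => R (flow1 t) (flow2 t))). now apply flow_field_ex_RInt.
    - now apply flow_field_continuous. }
  split.
  - apply is_derive_ext_loc with (2 := Hgen P x0 HP).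
    apply filter_imp with (2 := Hloc). intros t Ht. symmetry. now apply flow_integral.
  - apply is_derive_ext_loc with (2 := Hgen Q y0 HQ).
    apply filter_imp with (2 := Hloc). intros t Ht. symmetry. now apply flow_integral.
Qed.

Lemma flow_start : flow1 0 = x0 /\ flow2 0 = y0.
Proof.
  assert (H0 : Rabs 0 < h) by (now rewrite Rabs_R0).
  destruct (flow_integral 0 H0) as [H1 H2].
  rewrite RInt_point in H1, H2. unfold zero in H1, H2; simpl in H1, H2. lra.
Qed.

End Picard.

(** * Localization of a smooth field *)

Lemma continuity_2d_bounded g x y : continuity_2d_pt g x y ->
  exists d, 0 < d /\ forall u v, Rabs (u - x) < d -> Rabs (v - y) < d ->
    Rabs (g u v) <= Rabs (g x y) + 1.
Proof.
  intros H. destruct (H (mkposreal 1 Rlt_0_1)) as [d Hd].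
  exists d. split; [apply cond_pos|]. intros u v Hu Hv.
  specialize (Hd u v Hu Hv). simpl in Hd.
  assert (Ht := Rabs_triang (g u v - g x y) (g x y)).
  replace (g u v - g x y + g x y) with (g u v) in Ht by ring. lra.
Qed.

Lemma mean_value_bound (g : R -> R) K c d a b :
  (forall t, c < t < d -> ex_derive g t /\ Rabs (Derive g t) <= K) ->
  c < a < d -> c < b < d -> Rabs (g a - g b) <= K * Rabs (a - b).
Proof.
  intros H Ha Hb.
  assert (Hin : forall t, Rmin b a <= t <= Rmax b a -> c < t < d).
  { intros t. unfold Rmin, Rmax. destruct (Rle_dec b a); lra. }
  destruct (MVT_gen g b a (Derive g)) as [t [Ht Heq]].
  - intros t Ht. apply Derive_correct, H, Hin. lra.
  - intros t Ht. apply continuity_pt_filterlim, (ex_derive_continuous g), H, Hin, Ht.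
  - rewrite Heq, Rabs_mult. apply Rmult_le_compat_r; [apply Rabs_pos | apply H, Hin, Ht].
Qed.

(** The two points are joined by two sides of a rectangle, and the mean value theorem is applied on
    each side; continuity bounds the function and its partial derivatives by their central values
    plus 1. *)
Lemma smooth_local_lipschitz U g x y : open2 U -> smooth_on U g -> U x y ->
  exists d K, 0 < d /\ 0 <= K /\
    (forall u v, Rabs (u - x) < d -> Rabs (v - y) < d -> U u v /\ Rabs (g u v) <= K) /\
    (forall u v u' v', Rabs (u - x) < d -> Rabs (v - y) < d ->
       Rabs (u' - x) < d -> Rabs (v' - y) < d ->
       Rabs (g u v - g u' v') <= K * (Rabs (u - u') + Rabs (v - v'))).
Proof.
  intros HU Hg Hxy.
  destruct (HU x y Hxy) as [eps [Heps He]].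
  destruct (continuity_2d_bounded g x y) as [d0 [Hd0 H0]].
  { now apply (smooth_C1 U g). }
  destruct (continuity_2d_bounded (pd true g) x y) as [d1 [Hd1 H1]].
  { apply (smooth_C1 U); auto. now apply smooth_pd. }
  destruct (continuity_2d_bounded (pd false g) x y) as [d2 [Hd2 H2]].
  { apply (smooth_C1 U); auto. now apply smooth_pd. }
  set (K := Rabs (g x y) + Rabs (pd true g x y) + Rabs (pd false g x y) + 1).
  assert (HK0 := Rabs_pos (g x y)). assert (HK1 := Rabs_pos (pd true g x y)).
  assert (HK2 := Rabs_pos (pd false g x y)).
  set (d := Rmin (Rmin eps d0) (Rmin d1 d2)).
  assert (Hd : 0 < d) by (unfold d; repeat apply Rmin_glb_lt; assumption).
  assert (Hde : d <= eps /\ d <= d0 /\ d <= d1 /\ d <= d2).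
  { assert (A1 := Rmin_l (Rmin eps d0) (Rmin d1 d2)).
    assert (A2 := Rmin_r (Rmin eps d0) (Rmin d1 d2)).
    assert (A3 := Rmin_l eps d0). assert (A4 := Rmin_r eps d0).
    assert (A5 := Rmin_l d1 d2). assert (A6 := Rmin_r d1 d2). fold d in A1, A2. lra. }
  exists d, K. split; [exact Hd|split; [unfold K; lra|split]].
  - intros u v Hu Hv. split; [apply He; lra|].
    apply Rle_trans with (1 := H0 u v ltac:(lra) ltac:(lra)). unfold K; lra.
  - intros u v u' v' Hu Hv Hu' Hv'.
    assert (Hball : forall t z, z - d < t < z + d <-> Rabs (t - z) < d).
    { intros t z. split; intros Ht; [apply Rabs_lt_between; lra|].
      apply Rabs_lt_between in Ht. lra. }
    assert (Hx : Rabs (g u v - g u' v) <= K * Rabs (u - u')).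
    { apply (mean_value_bound (fun t => g t v) K (x - d) (x + d)); try now apply Hball.
      intros t Ht. apply Hball in Ht. split.
      - apply (smooth_C1 U g t v Hg) with (b := true). apply He; lra.
      - apply Rle_trans with (1 := H1 t v ltac:(lra) ltac:(lra)). unfold K; lra. }
    assert (Hy : Rabs (g u' v - g u' v') <= K * Rabs (v - v')).
    { apply (mean_value_bound (fun t => g u' t) K (y - d) (y + d)); try now apply Hball.
      intros t Ht. apply Hball in Ht. split.
      - apply (smooth_C1 U g u' t Hg) with (b := false). apply He; lra.
      - apply Rle_trans with (1 := H2 u' t ltac:(lra) ltac:(lra)). unfold K; lra. }
    replace (g u v - g u' v') with ((g u v - g u' v) + (g u' v - g u' v')) by ring.
    assert (Ht := Rabs_triang (g u v - g u' v) (g u' v - g u' v')). lra.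
Qed.

(** Retraction of the line onto [[z - d, z + d]]. Composition with it turns a field that is bounded
    and Lipschitz near a point into one that is so globally, as the Picard iteration requires. *)
Definition clamp (z d t : R) : R := Rmax (z - d) (Rmin (z + d) t).

Lemma clamp_near z d t : 0 <= d -> Rabs (clamp z d t - z) <= d.
Proof.
  intros Hd. apply Rabs_le_between. unfold clamp, Rmax, Rmin.
  destruct (Rle_dec (z + d) t); destruct (Rle_dec (z - d) _); lra.
Qed.

Lemma clamp_id z d t : Rabs (t - z) <= d -> clamp z d t = t.
Proof.
  intros Hd. apply Rabs_le_between in Hd. unfold clamp, Rmax, Rmin.
  destruct (Rle_dec (z + d) t); destruct (Rle_dec (z - d) _); lra.
Qed.

Lemma clamp_lipschitz z d s t : 0 <= d -> Rabs (clamp z d s - clamp z d t) <= Rabs (s - t).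
Proof.
  intros Hd. unfold clamp, Rmax, Rmin.
  destruct (Rle_dec (z + d) s); destruct (Rle_dec (z + d) t);
  repeat match goal with |- context [Rle_dec ?p ?q] => destruct (Rle_dec p q) end;
    unfold Rabs; repeat match goal with |- context [Rcase_abs ?p] => destruct (Rcase_abs p) end;
    lra.
Qed.

Lemma planar_integral_curve U a b x y :
  open2 U -> smooth_on U a -> smooth_on U b -> U x y ->
  exists h c1 c2, 0 < h /\ c1 0 = x /\ c2 0 = y /\
    forall s, - h < s < h -> U (c1 s) (c2 s) /\
      is_derive c1 s (a (c1 s) (c2 s)) /\ is_derive c2 s (b (c1 s) (c2 s)).
Proof.
  intros HU Ha Hb Hxy.
  destruct (smooth_local_lipschitz U a x y HU Ha Hxy) as [da [Ka [Hda [HKa [Ha1 Ha2]]]]].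
  destruct (smooth_local_lipschitz U b x y HU Hb Hxy) as [db [Kb [Hdb [HKb [Hb1 Hb2]]]]].
  (* Halving keeps the closed box of clamped values inside both open boxes where the estimates
     hold. *)
  set (K := Ka + Kb). set (d := Rmin da db / 2).
  assert (Hmin := Rmin_glb_lt da db 0 Hda Hdb).
  assert (Hml := Rmin_l da db). assert (Hmr := Rmin_r da db).
  assert (Hd : 0 < d) by (unfold d; lra).
  set (P := fun u v => a (clamp x d u) (clamp y d v)).
  set (Q := fun u v => b (clamp x d u) (clamp y d v)).
  assert (Hca : forall z t, Rabs (clamp z d t - z) < da).
  { intros z t. apply Rle_lt_trans with (1 := clamp_near z d t ltac:(lra)). unfold d; lra. }
  assert (Hcb : forall z t, Rabs (clamp z d t - z) < db).
  { intros z t. apply Rle_lt_trans with (1 := clamp_near z d t ltac:(lra)). unfold d; lra. }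
  assert (Hlip : forall k u v u' v', 0 <= k <= K ->
    k * (Rabs (clamp x d u - clamp x d u') + Rabs (clamp y d v - clamp y d v'))
    <= K * (Rabs (u - u') + Rabs (v - v'))).
  { intros k u v u' v' Hk.
    assert (H1 := clamp_lipschitz x d u u' ltac:(lra)).
    assert (H2 := clamp_lipschitz y d v v' ltac:(lra)).
    assert (A1 := Rabs_pos (clamp x d u - clamp x d u')).
    assert (A2 := Rabs_pos (clamp y d v - clamp y d v')).
    apply Rmult_le_compat; lra. }
  assert (HP : lip2 K P).
  { intros u v u' v'. apply Rle_trans with (1 := Ha2 _ _ _ _ (Hca _ _) (Hca _ _) (Hca _ _) (Hca _ _)).
    apply Hlip. unfold K; lra. }
  assert (HQ : lip2 K Q).
  { intros u v u' v'. apply Rle_trans with (1 := Hb2 _ _ _ _ (Hcb _ _) (Hcb _ _) (Hcb _ _) (Hcb _ _)).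
    apply Hlip. unfold K; lra. }
  assert (HMP : forall u v, Rabs (P u v) <= K + 1).
  { intros u v. apply Rle_trans with Ka; [apply Ha1; apply Hca | unfold K; lra]. }
  assert (HMQ : forall u v, Rabs (Q u v) <= K + 1).
  { intros u v. apply Rle_trans with Kb; [apply Hb1; apply Hcb | unfold K; lra]. }
  assert (HK : 0 <= K) by (unfold K; lra).
  (* The bound by [d] makes speed times time, [(K + 1) h], at most [d], so the flow stays where
     clamping is the identity; the bound by 1 gives [4 K h <= 1]. *)
  set (h := Rmin d 1 / (4 * (K + 1))).
  assert (Hmd := Rmin_glb_lt d 1 0 Hd Rlt_0_1).
  assert (Hh : 0 < h) by (apply Rdiv_lt_0_compat; lra).
  assert (Hh4 : 4 * (K + 1) * h = Rmin d 1) by (unfold h; field; lra).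
  assert (Hm1 := Rmin_l d 1). assert (Hm2 := Rmin_r d 1).
  assert (HLh : 4 * K * h <= 1) by nra.
  destruct (flow_start P Q K (K + 1) x y h HK HP HQ HMP HMQ Hh HLh) as [Hs1 Hs2].
  exists h, (flow1 P Q x y), (flow2 P Q x y).
  split; [exact Hh|split; [exact Hs1|split; [exact Hs2|]]].
  intros s Hs. assert (Hs' : Rabs s < h) by (apply Rabs_lt_between; lra).
  assert (H0h : Rabs 0 <= h) by (rewrite Rabs_R0; lra).
  destruct (flow_derive P Q K (K + 1) x y h HK HP HQ HMP HMQ Hh HLh s Hs') as [D1 D2].
  destruct (flow_lipschitz P Q K (K + 1) x y h HK HP HQ HMP HMQ Hh HLh 0 s H0h ltac:(lra))
    as [L1 L2].
  rewrite Hs1 in L1. rewrite Hs2 in L2. rewrite Rminus_0_r in L1, L2.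
  assert (Hsd : (K + 1) * Rabs s <= d) by nra.
  assert (E1 := clamp_id x d _ (Rle_trans _ _ _ L1 Hsd)).
  assert (E2 := clamp_id y d _ (Rle_trans _ _ _ L2 Hsd)).
  assert (EP : P (flow1 P Q x y s) (flow2 P Q x y s) = a (flow1 P Q x y s) (flow2 P Q x y s))
    by (unfold P at 1; now rewrite E1, E2).
  assert (EQ : Q (flow1 P Q x y s) (flow2 P Q x y s) = b (flow1 P Q x y s) (flow2 P Q x y s))
    by (unfold Q at 1; now rewrite E1, E2).
  rewrite EP in D1. rewrite EQ in D2.
  split; [rewrite <- E1, <- E2; apply (Ha1 _ _ (Hca _ _) (Hca _ _)) | now split].
Qed.

(** * Moving frames in four-space *)

Definition dotf (u v : surf) : R -> R -> R := fun x y => dot4 (pt u x y) (pt v x y).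
Definition pdv (b : bool) (u : surf) : surf := fun i => pd b (u i).
Definition smv (U : R -> R -> Prop) (u : surf) : Prop :=
  forall i, (i < 4)%nat -> smooth_on U (u i).

Lemma dotf_sym u v x y : dotf u v x y = dotf v u x y.
Proof. unfold dotf, dot4. ring. Qed.

Lemma smooth_pdv U b u : smv U u -> smv U (pdv b u).
Proof. intros H i Hi. apply smooth_pd. now apply H. Qed.

Ltac smooth :=
  lazymatch goal with
  | |- smooth_on _ (fun x y => @?g x y + @?h x y) =>
      apply (smooth_plus _ g h); [assumption | smooth | smooth]
  | |- smooth_on _ (fun x y => @?g x y - @?h x y) =>
      apply (smooth_minus _ g h); [assumption | smooth | smooth]
  | |- smooth_on _ (fun x y => @?g x y * @?h x y) =>
      apply (smooth_mult _ g h); [assumption | smooth | smooth]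
  | |- smooth_on _ (fun x y => - @?g x y) =>
      apply (smooth_opp _ g); [assumption | smooth]
  | H : smv ?U ?u |- smooth_on ?U (fun x y => ?u ?i x y) => exact (H i ltac:(lia))
  | H : smv ?U ?u |- smooth_on ?U (?u ?i) => exact (H i ltac:(lia))
  | |- _ => eassumption
  end.

Lemma smooth_dotf U u v : open2 U -> smv U u -> smv U v -> smooth_on U (dotf u v).
Proof. intros HU Hu Hv. unfold dotf, dot4, pt. smooth. Qed.

Lemma pd_dotf U b u v x y : open2 U -> smv U u -> smv U v -> U x y ->
  pd b (dotf u v) x y = dotf (pdv b u) v x y + dotf u (pdv b v) x y.
Proof.
  intros HU Hu Hv Hxy. unfold dotf at 1, dot4, pt.
  rewrite (pd_plus U b (fun x y => u 0%nat x y * v 0%nat x y + u 1%nat x y * v 1%nat x y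
      + u 2%nat x y * v 2%nat x y) (fun x y => u 3%nat x y * v 3%nat x y)); [|smooth|smooth|assumption].
  rewrite (pd_plus U b (fun x y => u 0%nat x y * v 0%nat x y + u 1%nat x y * v 1%nat x y)
     (fun x y => u 2%nat x y * v 2%nat x y)); [|smooth|smooth|assumption].
  rewrite (pd_plus U b (fun x y => u 0%nat x y * v 0%nat x y)
     (fun x y => u 1%nat x y * v 1%nat x y)); [|smooth|smooth|assumption].
  assert (Hm : forall i, (i < 4)%nat -> pd b (fun x y => u i x y * v i x y) x y
      = pd b (u i) x y * v i x y + u i x y * pd b (v i) x y).
  { intros i Hi. apply (pd_mult U); [now apply Hu | now apply Hv | assumption]. }
  rewrite (Hm 0%nat), (Hm 1%nat), (Hm 2%nat), (Hm 3%nat) by lia.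
  unfold dotf, dot4, pt, pdv. ring.
Qed.

(* The second derivatives of u cancel by symmetry. *)
Lemma cartan U u v x y : open2 U -> smv U u -> smv U v -> U x y ->
  pd false (dotf (pdv true u) v) x y - pd true (dotf (pdv false u) v) x y
  = dotf (pdv true u) (pdv false v) x y - dotf (pdv false u) (pdv true v) x y.
Proof.
  intros HU Hu Hv Hxy.
  rewrite !(pd_dotf U); auto using smooth_pdv.
  assert (H : dotf (pdv false (pdv true u)) v x y = dotf (pdv true (pdv false u)) v x y).
  { unfold dotf, dot4, pt, pdv.
    rewrite !(pd_comm U false true); auto; apply Hu; lia. }
  rewrite H. ring.
Qed.

(** * Orthonormal frames and Parseval's identity *)

Definition kron (j k : nat) : R := if Nat.eqb j k then 1 else 0.
Definition orthonormal (e : nat -> vec4) : Prop :=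
  forall j k, (j < 4)%nat -> (k < 4)%nat -> dot4 (e j) (e k) = kron j k.

Ltac nat4 i Hi :=
  destruct i as [|[|[|[|i]]]]; [| | | | exfalso; clear - Hi; lia].

Lemma kron_sym j k : kron j k = kron k j.
Proof. unfold kron. now rewrite Nat.eqb_sym. Qed.

Lemma sum4_nonneg (a : nat -> R) : (forall i, 0 <= a i) ->
  a 0%nat + a 1%nat + a 2%nat + a 3%nat = 0 -> forall i, (i < 4)%nat -> a i = 0.
Proof.
  intros Ha H i Hi.
  assert (H0 := Ha 0%nat). assert (H1 := Ha 1%nat).
  assert (H2 := Ha 2%nat). assert (H3 := Ha 3%nat).
  nat4 i Hi; lra.
Qed.

(* If F^T F = 1 then Q = F F^T - 1 satisfies tr (Q^2) = 0, and Q is symmetric. *)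
Lemma orthonormal_transpose e : orthonormal e -> orthonormal (fun i k => e k i).
Proof.
  intros He.
  set (Q := fun i j => dot4 (fun k => e k i) (fun k => e k j) - kron i j).
  set (s := fun i => Q i 0%nat ^ 2 + Q i 1%nat ^ 2 + Q i 2%nat ^ 2 + Q i 3%nat ^ 2).
  assert (HS : s 0%nat + s 1%nat + s 2%nat + s 3%nat = 0).
  { transitivity
     ((dot4 (e 0%nat) (e 0%nat) ^ 2 + dot4 (e 1%nat) (e 1%nat) ^ 2
       + dot4 (e 2%nat) (e 2%nat) ^ 2 + dot4 (e 3%nat) (e 3%nat) ^ 2)
      + 2 * (dot4 (e 0%nat) (e 1%nat) ^ 2 + dot4 (e 0%nat) (e 2%nat) ^ 2
       + dot4 (e 0%nat) (e 3%nat) ^ 2 + dot4 (e 1%nat) (e 2%nat) ^ 2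
       + dot4 (e 1%nat) (e 3%nat) ^ 2 + dot4 (e 2%nat) (e 3%nat) ^ 2)
      - 2 * (dot4 (e 0%nat) (e 0%nat) + dot4 (e 1%nat) (e 1%nat)
       + dot4 (e 2%nat) (e 2%nat) + dot4 (e 3%nat) (e 3%nat)) + 4).
    - unfold s, Q, kron, dot4. simpl Nat.eqb. cbv iota. ring.
    - rewrite !He by lia. unfold kron. simpl. ring. }
  assert (Hs : forall i, (i < 4)%nat -> s i = 0).
  { apply sum4_nonneg; [|exact HS]. intros i. unfold s.
    assert (H0 := pow2_ge_0 (Q i 0%nat)). assert (H1 := pow2_ge_0 (Q i 1%nat)).
    assert (H2 := pow2_ge_0 (Q i 2%nat)). assert (H3 := pow2_ge_0 (Q i 3%nat)). lra. }
  intros i j Hi Hj.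
  assert (HQ := sum4_nonneg (fun j => Q i j ^ 2) (fun j => pow2_ge_0 (Q i j)) (Hs i Hi) j Hj).
  apply Rminus_diag_uniq. change (Q i j = 0). simpl in HQ.
  rewrite Rmult_1_r in HQ. destruct (Rmult_integral _ _ HQ); assumption.
Qed.

Lemma dot4_kron u i : (i < 4)%nat -> dot4 u (fun j => kron j i) = u i.
Proof. intros Hi. unfold dot4, kron. nat4 i Hi; simpl; ring. Qed.

Lemma frame_expansion e u i : orthonormal e -> (i < 4)%nat ->
  u i = dot4 (fun k => dot4 u (e k)) (fun k => e k i).
Proof.
  intros He Hi. apply orthonormal_transpose in He.
  assert (H : forall j, (j < 4)%nat -> dot4 (fun k => e k j) (fun k => e k i) = kron j i)
    by (intros; now apply He).
  transitivity (dot4 u (fun j => dot4 (fun k => e k j) (fun k => e k i))).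
  - transitivity (dot4 u (fun j => kron j i)); [now rewrite dot4_kron|].
    unfold dot4 at 1 2. rewrite !H by lia. reflexivity.
  - unfold dot4. ring.
Qed.

Lemma dot4_ext u v u' v' : (forall i, (i < 4)%nat -> u i = u' i) ->
  (forall i, (i < 4)%nat -> v i = v' i) -> dot4 u v = dot4 u' v'.
Proof. intros Hu Hv. unfold dot4. rewrite !Hu, !Hv by lia. reflexivity. Qed.

Lemma parseval e u v : orthonormal e ->
  dot4 u v = dot4 (fun k => dot4 u (e k)) (fun k => dot4 v (e k)).
Proof.
  intros He.
  transitivity (dot4 (fun i => dot4 (fun k => dot4 u (e k)) (fun k => e k i)) v).
  - apply dot4_ext; auto. intros i Hi. now apply frame_expansion.
  - generalize (fun k => dot4 u (e k)). intros a. unfold dot4. ring.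
Qed.

Definition frame_at (e : nat -> surf) x y : nat -> vec4 := fun k => pt (e k) x y.

(* Structure equations of a minimal surface in the 3-sphere ruled by great circles, in the
   frame (position, ruling direction, tangent orthogonal to it, normal); [w1], [w2] is the
   dual coframe and the boolean selects one of the two coordinate directions. *)
Definition ruled_frame (U : R -> R -> Prop) (e : nat -> surf)
    (w1 w2 : bool -> R -> R -> R) (q tau : R -> R -> R) : Prop :=
  forall b x y, U x y ->
    (forall i, (i < 4)%nat ->
      pd b (e 0%nat i) x y = w1 b x y * e 1%nat i x y + w2 b x y * e 2%nat i x y /\
      pd b (e 1%nat i) x y = - w1 b x y * e 0%nat i x y + q x y * w2 b x y * e 2%nat i x y
         + tau x y * w2 b x y * e 3%nat i x y /\
      pd b (e 2%nat i) x y = - w2 b x y * e 0%nat i x y - q x y * w2 b x y * e 1%nat i x y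
         + tau x y * w1 b x y * e 3%nat i x y /\
      pd b (e 3%nat i) x y = - tau x y * w2 b x y * e 1%nat i x y
         - tau x y * w1 b x y * e 2%nat i x y) /\
    pd b tau x y = - 2 * q x y * tau x y * w1 b x y /\
    pd b q x y = (tau x y ^ 2 - 1 - q x y ^ 2) * w1 b x y.

(** * Connection forms and the structure equations *)

Section Frame.
Variables (U : R -> R -> Prop) (e : nat -> surf) (q tau : R -> R -> R).
Hypothesis HU : open2 U.
Hypothesis He : forall k, (k < 4)%nat -> smv U (e k).
Hypothesis Ho : forall x y, U x y -> orthonormal (frame_at e x y).

(** Connection forms, [d e_j = sum_k om j k e_k]. As [e 0] is the position, [om 0 1] and [om 0 2]
    are the coframe dual to [e 1], [e 2]. *)
Definition om (j k : nat) (b : bool) : R -> R -> R := dotf (pdv b (e j)) (e k).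

Lemma om_skew j k b x y : (j < 4)%nat -> (k < 4)%nat -> U x y ->
  om k j b x y = - om j k b x y.
Proof.
  intros Hj Hk Hxy.
  assert (H := pd_dotf U b (e j) (e k) x y HU (He j Hj) (He k Hk) Hxy).
  rewrite (pd_ext U (dotf (e j) (e k)) (fun _ _ => kron j k)), pd_const in H; auto.
  - unfold om. rewrite (dotf_sym (pdv b (e k))). lra.
  - intros u v Huv. now apply (Ho u v Huv).
Qed.

Lemma om_diag j b x y : (j < 4)%nat -> U x y -> om j j b x y = 0.
Proof. intros Hj Hxy. assert (H := om_skew j j b x y Hj Hj Hxy). lra. Qed.

Lemma pd_frame j b i x y : (j < 4)%nat -> (i < 4)%nat -> U x y ->
  pd b (e j i) x y = dot4 (fun k => om j k b x y) (fun k => e k i x y).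
Proof.
  intros Hj Hi Hxy.
  exact (frame_expansion _ (pt (pdv b (e j)) x y) i (Ho x y Hxy) Hi).
Qed.

Lemma cartan_frame j k x y : (j < 4)%nat -> (k < 4)%nat -> U x y ->
  pd false (om j k true) x y - pd true (om j k false) x y
  = dot4 (fun m => om j m true x y) (fun m => om k m false x y)
    - dot4 (fun m => om j m false x y) (fun m => om k m true x y).
Proof.
  intros Hj Hk Hxy. unfold om at 1 2.
  rewrite (cartan U) by auto.
  f_equal; apply (parseval (frame_at e x y)); now apply Ho.
Qed.

Hypothesis Hq : smooth_on U q.
Hypothesis Htau : smooth_on U tau.
Hypothesis H03 : forall b x y, U x y -> om 0 3 b x y = 0.
Hypothesis H12 : forall b x y, U x y -> om 1 2 b x y = q x y * om 0 2 b x y.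
Hypothesis H13 : forall b x y, U x y -> om 1 3 b x y = tau x y * om 0 2 b x y.
Hypothesis H23 : forall b x y, U x y -> om 2 3 b x y = tau x y * om 0 1 b x y.
Hypothesis HJ : forall x y, U x y ->
  om 0 1 true x y * om 0 2 false x y - om 0 1 false x y * om 0 2 true x y <> 0.
Hypothesis Htau0 : forall x y, U x y -> tau x y <> 0.

Lemma smooth_om j k b : (j < 4)%nat -> (k < 4)%nat -> smooth_on U (om j k b).
Proof. intros Hj Hk. apply smooth_dotf; auto using smooth_pdv. Qed.

Lemma pd_om_mult c g j k b b' x y : (forall x y, U x y -> c x y = g x y * om j k b x y) ->
  (j < 4)%nat -> (k < 4)%nat -> smooth_on U g -> U x y ->
  pd b' c x y = pd b' g x y * om j k b x y + g x y * pd b' (om j k b) x y.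
Proof.
  intros Hc Hj Hk Hg Hxy.
  rewrite (pd_ext U c (fun x y => g x y * om j k b x y)); auto.
  rewrite (pd_mult U); auto using smooth_om.
Qed.

(** In terms of 1-forms on the plane: [p /\ a = 0] and [p /\ b = 0] with [a], [b] independent. It
    converts the structure equations, which are identities of 2-forms, into formulas for [d tau] and
    [d q]. *)
Lemma cross_zero p1 p2 a1 a2 b1 b2 : a1 * b2 - a2 * b1 <> 0 ->
  p1 * a2 - p2 * a1 = 0 -> p1 * b2 - p2 * b1 = 0 -> p1 = 0 /\ p2 = 0.
Proof.
  intros HJ' H1 H2.
  assert (E1 : (a1 * b2 - a2 * b1) * p1 = 0).
  { replace ((a1 * b2 - a2 * b1) * p1) with
      (a1 * (p1 * b2 - p2 * b1) - b1 * (p1 * a2 - p2 * a1)) by ring.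
    rewrite H1, H2; ring. }
  assert (E2 : (a1 * b2 - a2 * b1) * p2 = 0).
  { replace ((a1 * b2 - a2 * b1) * p2) with
      (a2 * (p1 * b2 - p2 * b1) - b2 * (p1 * a2 - p2 * a1)) by ring.
    rewrite H1, H2; ring. }
  split; [destruct (Rmult_integral _ _ E1) | destruct (Rmult_integral _ _ E2)];
    try assumption; contradiction.
Qed.

(** Cartan's equations after substitution of the ruled form of the connection: the first two are the
    torsion equations, the third is the Gauss equation, the last two are the Codazzi equations. The
    left sides are minus the exterior derivatives on the coordinate vectors, and [J] is the area
    form [w1 /\ w2] on them. *)
Lemma d_om x y : U x y ->
  let J := om 0 1 true x y * om 0 2 false x y - om 0 1 false x y * om 0 2 true x y in
  pd false (om 0 1 true) x y - pd true (om 0 1 false) x y = 0 /\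
  pd false (om 0 2 true) x y - pd true (om 0 2 false) x y = - q x y * J /\
  pd false (om 1 2 true) x y - pd true (om 1 2 false) x y = (1 - tau x y ^ 2) * J /\
  pd false (om 1 3 true) x y - pd true (om 1 3 false) x y = q x y * tau x y * J /\
  pd false (om 2 3 true) x y - pd true (om 2 3 false) x y = 0.
Proof.
  intros Hxy J. rewrite !cartan_frame by (auto; lia).
  assert (S : forall b j k, (j < 4)%nat -> (k < 4)%nat -> om k j b x y = - om j k b x y)
    by (intros; now apply om_skew).
  unfold dot4.
  rewrite !om_diag by (auto; lia).
  rewrite !(S _ 0 1)%nat, !(S _ 0 2)%nat, !(S _ 0 3)%nat, !(S _ 1 2)%nat, !(S _ 1 3)%nat,
    !(S _ 2 3)%nat by lia.
  rewrite !H03, !H12, !H13, !H23 by assumption. unfold J.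
  repeat split; ring.
Qed.

(** With [w1] closed and [d w2 = q w1 /\ w2], the Codazzi equations become
    [d tau /\ w2 = - 2 q tau w1 /\ w2] and [d tau /\ w1 = 0]. *)
Lemma d_tau x y : U x y -> forall b, pd b tau x y = - 2 * q x y * tau x y * om 0 1 b x y.
Proof.
  intros Hxy. destruct (d_om x y Hxy) as [D01 [D02 [D12 [D13 D23]]]].
  assert (HJxy := HJ x y Hxy).
  rewrite !(pd_om_mult (om 1 3 _) tau 0 2 _) in D13 by auto with arith.
  rewrite !(pd_om_mult (om 2 3 _) tau 0 1 _) in D23 by auto with arith.
  set (p b := pd b tau x y + 2 * q x y * tau x y * om 0 1 b x y).
  destruct (cross_zero (p false) (p true) (om 0 1 false x y) (om 0 1 true x y)
    (om 0 2 false x y) (om 0 2 true x y)) as [E1 E2].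
  - lra.
  - unfold p. nra.
  - unfold p. nra.
  - unfold p in *. intros [|]; lra.
Qed.

(** The Gauss equation gives [dq /\ w2 = (tau^2 - 1 - q^2) w1 /\ w2]. For [dq /\ w1 = 0], apply [d]
    to [d tau = - 2 q tau w1]: as [w1] is closed and [d tau /\ w1 = 0], only [- 2 tau dq /\ w1] is
    left, and [tau] is nonzero. *)
Lemma d_q x y : U x y -> forall b,
  pd b q x y = (tau x y ^ 2 - 1 - q x y ^ 2) * om 0 1 b x y.
Proof.
  intros Hxy. destruct (d_om x y Hxy) as [D01 [D02 [D12 [D13 D23]]]].
  assert (HJxy := HJ x y Hxy). assert (Ht0 := Htau0 x y Hxy).
  rewrite !(pd_om_mult (om 1 2 _) q 0 2 _) in D12 by auto with arith.
  assert (Hqt : smooth_on U (fun x y => -2 * q x y * tau x y)).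
  { assert (smooth_on U (fun _ _ => -2)) by apply smooth_const. smooth. }
  assert (Hpqt : forall b, pd b (fun x y => -2 * q x y * tau x y) x y
     = -2 * pd b q x y * tau x y - 2 * q x y * pd b tau x y).
  { intros b.
    assert (Hc : smooth_on U (fun _ _ => -2)) by apply smooth_const.
    rewrite (pd_mult U b (fun x y => -2 * q x y) tau); [|smooth|smooth|assumption].
    rewrite (pd_mult U b (fun x y => -2) q); [|smooth|smooth|assumption].
    rewrite pd_const. ring. }
  assert (D : pd false (pd true tau) x y = pd true (pd false tau) x y)
    by (apply (pd_comm U); auto).
  rewrite !(pd_om_mult (pd _ tau) (fun x y => -2 * q x y * tau x y) 0 1 _) in D
    by (auto with arith; intros; now apply d_tau).
  rewrite !Hpqt, !(d_tau x y Hxy) in D.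
  set (p b := pd b q x y - (tau x y ^ 2 - 1 - q x y ^ 2) * om 0 1 b x y).
  destruct (cross_zero (p false) (p true) (om 0 1 false x y) (om 0 1 true x y)
    (om 0 2 false x y) (om 0 2 true x y)) as [E1 E2].
  - lra.
  - unfold p. apply Rmult_eq_reg_l with (-2 * tau x y); [|lra]. nra.
  - unfold p. nra.
  - unfold p in *. intros [|]; lra.
Qed.

Lemma ruled_frame_of_forms : ruled_frame U e (om 0 1) (om 0 2) q tau.
Proof.
  intros b x y Hxy. split; [|split; [now apply d_tau | now apply d_q]].
  assert (S : forall b j k, (j < 4)%nat -> (k < 4)%nat -> om k j b x y = - om j k b x y)
    by (intros; now apply om_skew).
  intros i Hi. rewrite !pd_frame by (auto; lia). unfold dot4.
  rewrite !om_diag by (auto; lia).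
  rewrite !(S _ 0 1)%nat, !(S _ 0 2)%nat, !(S _ 0 3)%nat, !(S _ 1 2)%nat, !(S _ 1 3)%nat,
    !(S _ 2 3)%nat by lia.
  rewrite !H03, !H12, !H13, !H23 by assumption.
  repeat split; ring.
Qed.

End Frame.

(** * Connectedness and the frame of the Lawson torus *)

(** Any two points of a small box around a point are joined by a horizontal and a vertical segment,
    so membership in [W] is constant near every point of [U]. Hence both [W] and its complement are
    open in [U]. *)
Lemma connected_by_segments (U W : R -> R -> Prop) x0 y0 :
  open2 U -> connected2 U ->
  (forall b x y lo hi t1 t2, (forall t, lo < t < hi -> slice b U x y t) ->
     lo < t1 < hi -> lo < t2 < hi -> slice b W x y t1 -> slice b W x y t2) ->
  U x0 y0 -> W x0 y0 -> forall x y, U x y -> W x y.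
Proof.
  intros HU HC Hstep HU0 HW0.
  assert (Hball : forall t z d, Rabs (t - z) < d -> z - d < t < z + d).
  { intros t z d Ht. apply Rabs_lt_between in Ht. lra. }
  assert (Hball' : forall t z d, z - d < t < z + d -> Rabs (t - z) < d).
  { intros t z d Ht. apply Rabs_lt_between. lra. }
  assert (Hlocal : forall x y, U x y -> exists eps, 0 < eps /\ forall u v,
    Rabs (u - x) < eps -> Rabs (v - y) < eps -> U u v /\ (W x y <-> W u v)).
  { intros x y Hxy. destruct (HU x y Hxy) as [eps [Heps He]].
    exists eps. split; [assumption|]. intros u v Hu Hv.
    split; [now apply He|].
    assert (Hxx : x - eps < x < x + eps) by lra.
    assert (Hyy : y - eps < y < y + eps) by lra.
    (* The [0] fills the coordinate that [slice] ignores. *)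
    assert (S1 : forall t, x - eps < t < x + eps -> slice true U 0 y t).
    { intros t Ht. apply He; [now apply Hball'|]. rewrite Rminus_diag, Rabs_R0. lra. }
    assert (S2 : forall t, y - eps < t < y + eps -> slice false U u 0 t).
    { intros t Ht. apply He; [assumption|]. now apply Hball'. }
    apply Hball in Hu. apply Hball in Hv.
    split; intros HW.
    - apply (Hstep false u 0 _ _ y v S2 Hyy Hv).
      exact (Hstep true 0 y _ _ x u S1 Hxx Hu HW).
    - apply (Hstep true 0 y _ _ u x S1 Hu Hxx).
      exact (Hstep false u 0 _ _ v y S2 Hv Hyy HW). }
  destruct (HC (fun x y => U x y /\ W x y) (fun x y => U x y /\ ~ W x y)) as [H|H].
  - intros x y [Hxy HW]. destruct (Hlocal x y Hxy) as [eps [Heps He]].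
    exists eps. split; [assumption|]. intros u v Hu Hv.
    destruct (He u v Hu Hv) as [H1 H2]. tauto.
  - intros x y [Hxy HW]. destruct (Hlocal x y Hxy) as [eps [Heps He]].
    exists eps. split; [assumption|]. intros u v Hu Hv.
    destruct (He u v Hu Hv) as [H1 H2]. tauto.
  - intros x y Hxy. destruct (classic (W x y)); tauto.
  - tauto.
  - intros x y Hxy. now apply H.
  - exfalso. now apply (H x0 y0).
Qed.

Lemma zero_derive_const F lo hi t1 t2 :
  (forall t, lo < t < hi -> is_derive F t 0) -> lo < t1 < hi -> lo < t2 < hi -> F t1 = F t2.
Proof.
  intros H H1 H2. destruct (Rtotal_order t1 t2) as [Hlt|[->|Hlt]]; [|reflexivity|symmetry];
    apply (eq_is_derive F); try assumption; intros t Ht; apply H; lra.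
Qed.

Lemma connected_constant (U : R -> R -> Prop) g x0 y0 :
  open2 U -> connected2 U -> (forall b x y, U x y -> is_derive (slice b g x y) (coord b x y) 0) ->
  U x0 y0 -> forall x y, U x y -> g x y = g x0 y0.
Proof.
  intros HU HC Hd H0.
  apply (connected_by_segments U (fun x y => g x y = g x0 y0) x0 y0); auto.
  intros b x y lo hi t1 t2 HUs Ht1 Ht2 HW.
  assert (H := zero_derive_const (slice b g x y) lo hi t1 t2).
  destruct b; simpl in *; rewrite <- HW; symmetry; apply H; auto; intros t Ht.
  - now apply (Hd true t y), HUs.
  - now apply (Hd false x t), HUs.
Qed.

Lemma Derive_eta (f : R -> R) x l : is_derive f x l -> Derive (fun t : R => f t) x = l.
Proof. apply is_derive_unique. Qed.

(** The difference of two solutions solves the same linear system, whose matrix is skew, so its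
    squared norm [D] is constant along the interval. *)
Lemma skew_ode_unique lo hi r1 r2 (th1 th2 q tau : R -> R) (E0 E1 E2 E3 G0 G1 G2 G3 : R -> R) :
  (forall r, lo < r < hi ->
    is_derive E0 r (th1 r * E1 r + th2 r * E2 r) /\
    is_derive E1 r (- th1 r * E0 r + q r * th2 r * E2 r + tau r * th2 r * E3 r) /\
    is_derive E2 r (- th2 r * E0 r - q r * th2 r * E1 r + tau r * th1 r * E3 r) /\
    is_derive E3 r (- tau r * th2 r * E1 r - tau r * th1 r * E2 r)) ->
  (forall r, lo < r < hi ->
    is_derive G0 r (th1 r * G1 r + th2 r * G2 r) /\
    is_derive G1 r (- th1 r * G0 r + q r * th2 r * G2 r + tau r * th2 r * G3 r) /\
    is_derive G2 r (- th2 r * G0 r - q r * th2 r * G1 r + tau r * th1 r * G3 r) /\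
    is_derive G3 r (- tau r * th2 r * G1 r - tau r * th1 r * G2 r)) ->
  lo < r1 < hi -> lo < r2 < hi ->
  E0 r1 = G0 r1 -> E1 r1 = G1 r1 -> E2 r1 = G2 r1 -> E3 r1 = G3 r1 ->
  E0 r2 = G0 r2 /\ E1 r2 = G1 r2 /\ E2 r2 = G2 r2 /\ E3 r2 = G3 r2.
Proof.
  intros HE HG Hr1 Hr2 I0 I1 I2 I3.
  set (D := fun r => (E0 r - G0 r) ^ 2 + (E1 r - G1 r) ^ 2
                   + (E2 r - G2 r) ^ 2 + (E3 r - G3 r) ^ 2).
  assert (HD : D r2 = D r1).
  { apply (zero_derive_const D lo hi); auto. intros r Hr.
    destruct (HE r Hr) as [A0 [A1 [A2 A3]]]. destruct (HG r Hr) as [B0 [B1 [B2 B3]]].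
    unfold D. auto_derive.
    - repeat split; eexists; eassumption.
    - rewrite (Derive_eta _ _ _ A0), (Derive_eta _ _ _ A1),
        (Derive_eta _ _ _ A2), (Derive_eta _ _ _ A3),
        (Derive_eta _ _ _ B0), (Derive_eta _ _ _ B1),
        (Derive_eta _ _ _ B2), (Derive_eta _ _ _ B3). ring. }
  unfold D in HD. rewrite I0, I1, I2, I3, !Rminus_diag in HD.
  assert (S0 := pow2_ge_0 (E0 r2 - G0 r2)). assert (S1 := pow2_ge_0 (E1 r2 - G1 r2)).
  assert (S2 := pow2_ge_0 (E2 r2 - G2 r2)). assert (S3 := pow2_ge_0 (E3 r2 - G3 r2)).
  assert (Hz : forall z, z ^ 2 = 0 -> z = 0).
  { intros z Hz. simpl in Hz. rewrite Rmult_1_r in Hz. now destruct (Rmult_integral _ _ Hz). }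
  assert (Z0 : (E0 r2 - G0 r2) ^ 2 = 0) by lra. assert (Z1 : (E1 r2 - G1 r2) ^ 2 = 0) by lra.
  assert (Z2 : (E2 r2 - G2 r2) ^ 2 = 0) by lra. assert (Z3 : (E3 r2 - G3 r2) ^ 2 = 0) by lra.
  apply Hz in Z0, Z1, Z2, Z3. lra.
Qed.

(** Squared length of the coordinate vector d/dt of the Lawson torus; d/ds is a unit vector
    orthogonal to it. *)
Definition lawson_G (alpha s : R) : R := alpha ^ 2 * cos s ^ 2 + sin s ^ 2.

(* The frame adapted to the Lawson torus: position, d/ds, normalised d/dt, unit normal. *)
Definition lawson_frame_scaled (alpha g s t : R) (k : nat) : vec4 :=
  let c := cos s in let sn := sin s in
  match k with
  | 0%nat => lawson alpha s t
  | 1%nat => fun i => match i with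
      | 0%nat => - sn * cos (alpha * t) | 1%nat => - sn * sin (alpha * t)
      | 2%nat => c * cos t | _ => c * sin t end
  | 2%nat => fun i => match i with
      | 0%nat => - g * alpha * c * sin (alpha * t) | 1%nat => g * alpha * c * cos (alpha * t)
      | 2%nat => - g * sn * sin t | _ => g * sn * cos t end
  | _ => fun i => match i with
      | 0%nat => g * sn * sin (alpha * t) | 1%nat => - g * sn * cos (alpha * t)
      | 2%nat => - g * alpha * c * sin t | _ => g * alpha * c * cos t end
  end.

(** The normalizing factor is an argument of [lawson_frame_scaled] so that it can be treated as an
    opaque function with known derivative when the frame is differentiated. *)
Definition lawson_frame (alpha s t : R) : nat -> vec4 :=
  lawson_frame_scaled alpha (/ sqrt (lawson_G alpha s)) s t.

Lemma lawson_G_pos alpha s : 1 < alpha -> 0 < lawson_G alpha s.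
Proof.
  intros Ha. unfold lawson_G. assert (H := sin2_cos2 s). unfold Rsqr in H. nra.
Qed.

Lemma inv_sqrt_sqr G : 0 < G -> / sqrt G * / sqrt G * G = 1.
Proof.
  intros HG. assert (Hs := sqrt_lt_R0 _ HG).
  rewrite <- (sqrt_sqrt G) at 3 by lra. field. lra.
Qed.

Lemma lawson_frame_orthonormal alpha s t : 1 < alpha -> orthonormal (lawson_frame alpha s t).
Proof.
  intros Ha.
  assert (HG := inv_sqrt_sqr _ (lawson_G_pos alpha s Ha)).
  unfold lawson_frame, lawson_frame_scaled. unfold lawson_G in HG at 3.
  set (g := / sqrt (lawson_G alpha s)) in *.
  assert (Hs : sin s * sin s = 1 - cos s * cos s).
  { assert (H := sin2_cos2 s). unfold Rsqr in H. lra. }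
  assert (Hat : sin (alpha * t) * sin (alpha * t) = 1 - cos (alpha * t) * cos (alpha * t)).
  { assert (H := sin2_cos2 (alpha * t)). unfold Rsqr in H. lra. }
  assert (Ht : sin t * sin t = 1 - cos t * cos t).
  { assert (H := sin2_cos2 t). unfold Rsqr in H. lra. }
  intros j k Hj Hk. unfold kron, dot4.
  nat4 j Hj; nat4 k Hk; simpl; try ring [Hs Hat Ht]; rewrite <- HG; ring [Hs Hat Ht].
Qed.

(** * The Lawson frame along a curve of parameters *)

Section LawsonCurve.
Variables (alpha lo hi r1 : R) (th1 th2 q tau S T : R -> R).
Hypotheses (Ha : 1 < alpha) (Hr1 : lo < r1 < hi).
Let C := alpha + / alpha.
Let rho := (alpha - / alpha) / 2.
Hypothesis HS : forall r, lo < r < hi -> is_derive S r (th1 r).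
Hypothesis HT : forall r, lo < r < hi -> is_derive T r (th2 r * / sqrt (lawson_G alpha (S r))).
Hypothesis Htau0 : forall r, lo < r < hi -> 0 < tau r.
Hypothesis HC : forall r, lo < r < hi -> q r ^ 2 + 1 + tau r ^ 2 = C * tau r.
Hypothesis Htau : forall r, lo < r < hi -> is_derive tau r (- 2 * q r * tau r * th1 r).
Hypothesis Hq : forall r, lo < r < hi -> is_derive q r ((tau r ^ 2 - 1 - q r ^ 2) * th1 r).
Hypothesis Hu1 : / tau r1 - C / 2 = rho * cos (2 * S r1).
Hypothesis Hv1 : q r1 / tau r1 = - rho * sin (2 * S r1).

(** Put [u = / tau - C / 2] and [v = q / tau]. The relation [HC] turns the equations for [tau] and
    [q] into [u' = 2 v th1], [v' = - 2 u th1], so [(u + i v) exp (2 i S)] is constant; [HX] and [HY]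
    are its real and imaginary parts. The initial values make the constant equal to [rho]. *)
Lemma lawson_invariants r : lo < r < hi ->
  / tau r - C / 2 = rho * cos (2 * S r) /\ q r / tau r = - rho * sin (2 * S r).
Proof.
  intros Hr.
  assert (HX : (/ tau r - C / 2) * cos (2 * S r) - q r / tau r * sin (2 * S r)
    = (/ tau r1 - C / 2) * cos (2 * S r1) - q r1 / tau r1 * sin (2 * S r1)).
  { apply (zero_derive_const (fun r =>
      (/ tau r - C / 2) * cos (2 * S r) - q r / tau r * sin (2 * S r)) lo hi); auto.
    intros p Hp. assert (Hp0 := Htau0 p Hp). assert (HCp := HC p Hp).
    auto_derive.
    - repeat split; try lra; eexists; eauto.
    - rewrite (Derive_eta _ _ _ (Htau p Hp)), (Derive_eta _ _ _ (Hq p Hp)),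
        (Derive_eta _ _ _ (HS p Hp)).
      apply Rmult_eq_reg_r with (tau p * tau p); [|nra].
      field_simplify_eq; [|lra]. 
      replace (q p ^ 2) with (C * tau p - 1 - tau p ^ 2) by lra. ring. }
  assert (HY : (/ tau r - C / 2) * sin (2 * S r) + q r / tau r * cos (2 * S r)
    = (/ tau r1 - C / 2) * sin (2 * S r1) + q r1 / tau r1 * cos (2 * S r1)).
  { apply (zero_derive_const (fun r =>
      (/ tau r - C / 2) * sin (2 * S r) + q r / tau r * cos (2 * S r)) lo hi); auto.
    intros p Hp. assert (Hp0 := Htau0 p Hp). assert (HCp := HC p Hp).
    auto_derive.
    - repeat split; try lra; eexists; eauto.
    - rewrite (Derive_eta _ _ _ (Htau p Hp)), (Derive_eta _ _ _ (Hq p Hp)),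
        (Derive_eta _ _ _ (HS p Hp)).
      apply Rmult_eq_reg_r with (tau p * tau p); [|nra].
      field_simplify_eq; [|lra].
      replace (q p ^ 2) with (C * tau p - 1 - tau p ^ 2) by lra. ring. }
  rewrite Hu1, Hv1 in HX, HY.
  assert (Hc : sin (2 * S r) * sin (2 * S r) = 1 - cos (2 * S r) * cos (2 * S r)).
  { assert (H := sin2_cos2 (2 * S r)). unfold Rsqr in H. lra. }
  assert (Hc1 : sin (2 * S r1) * sin (2 * S r1) = 1 - cos (2 * S r1) * cos (2 * S r1)).
  { assert (H := sin2_cos2 (2 * S r1)). unfold Rsqr in H. lra. }
  set (u := / tau r - C / 2) in *. set (v := q r / tau r) in *.
  assert (EX : u * cos (2 * S r) - v * sin (2 * S r) = rho) by (rewrite HX; ring [Hc1]).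
  assert (EY : u * sin (2 * S r) + v * cos (2 * S r) = 0) by (rewrite HY; ring).
  split.
  - rewrite <- EX.
    transitivity (u * (cos (2 * S r) * cos (2 * S r) + sin (2 * S r) * sin (2 * S r))
      + 0 * 0); [rewrite Hc; ring|].
    transitivity ((u * cos (2 * S r) - v * sin (2 * S r)) * cos (2 * S r)
      + (u * sin (2 * S r) + v * cos (2 * S r)) * sin (2 * S r)); [ring|].
    rewrite EY. ring.
  - rewrite <- EX.
    transitivity (v * (cos (2 * S r) * cos (2 * S r) + sin (2 * S r) * sin (2 * S r)));
      [rewrite Hc; ring|].
    transitivity (- (u * cos (2 * S r) - v * sin (2 * S r)) * sin (2 * S r)
      + (u * sin (2 * S r) + v * cos (2 * S r)) * cos (2 * S r)); [ring|].
    rewrite EY. ring.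
Qed.

(** The invariants read back through the double angle formulas: [C / 2 + rho cos (2 s) = G / alpha]
    and [- rho sin (2 s) = (1 - alpha^2) sin s cos s / alpha], where [G] is [lawson_G alpha s]. *)
Lemma lawson_tau_q r : lo < r < hi ->
  let g := / sqrt (lawson_G alpha (S r)) in
  tau r = alpha * (g * g) /\ q r = (1 - alpha ^ 2) * sin (S r) * cos (S r) * (g * g).
Proof.
  intros Hr g. destruct (lawson_invariants r Hr) as [Hu Hv].
  assert (Ht := Htau0 r Hr). assert (HGp := lawson_G_pos alpha (S r) Ha).
  assert (Hg : g * g = / lawson_G alpha (S r)).
  { apply Rmult_eq_reg_r with (lawson_G alpha (S r)); [|lra].
    rewrite Rinv_l by lra. now apply inv_sqrt_sqr. }
  assert (Hs : sin (S r) * sin (S r) = 1 - cos (S r) * cos (S r)).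
  { assert (H := sin2_cos2 (S r)). unfold Rsqr in H. lra. }
  rewrite cos_2a_cos in Hu. rewrite sin_2a in Hv.
  assert (Hw : / tau r = lawson_G alpha (S r) / alpha).
  { unfold lawson_G. replace (/ tau r) with (/ tau r - C / 2 + C / 2) by ring.
    rewrite Hu. unfold rho, C. replace (sin (S r) ^ 2) with (1 - cos (S r) * cos (S r))
      by (rewrite <- Hs; ring). field. lra. }
  assert (Et : tau r = alpha * (g * g)).
  { rewrite Hg, <- (Rinv_inv (tau r)), Hw. field. lra. }
  split; [exact Et|].
  replace (q r) with (q r / tau r * tau r) by (field; lra).
  rewrite Hv, Et. unfold rho. field. lra.
Qed.

(** On the torus [q] is the logarithmic derivative of [sqrt G] with respect to [s]. *)
Lemma is_derive_inv_sqrt_G r : lo < r < hi ->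
  is_derive (fun r => / sqrt (lawson_G alpha (S r))) r
    (- q r * th1 r * / sqrt (lawson_G alpha (S r))).
Proof.
  intros Hr. destruct (lawson_tau_q r Hr) as [_ Eq].
  assert (HGp := lawson_G_pos alpha (S r) Ha).
  assert (HG : is_derive (fun r => lawson_G alpha (S r)) r
    (2 * (1 - alpha ^ 2) * sin (S r) * cos (S r) * th1 r)).
  { unfold lawson_G. auto_derive.
    - repeat split; eexists; eauto.
    - rewrite (Derive_eta _ _ _ (HS r Hr)). ring. }
  assert (H := is_derive_comp (fun t => / sqrt t) (fun r => lawson_G alpha (S r)) r _ _
    (is_derive_inv_sqrt _ HGp) HG).
  rewrite Eq.
  match type of H with is_derive _ _ ?l =>
    match goal with |- is_derive _ _ ?l' => replace l' with l; [exact H|] end end.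
  unfold scal; simpl; unfold mult; simpl. field.
  apply Rgt_not_eq, sqrt_lt_R0, HGp.
Qed.

(** On the torus the coframe is [w1 = ds], [w2 = sqrt G dt], which is why [S' = th1] and
    [T' = th2 / sqrt G] reproduce the prescribed forms. Pairing with a fixed [a], later a row of the
    orthogonal matrix, reduces the equations for vectors to four scalar ones. *)
Lemma lawson_row_ode (a : vec4) r : lo < r < hi ->
  let G k r := dot4 a (lawson_frame alpha (S r) (T r) k) in
    is_derive (G 0%nat) r (th1 r * G 1%nat r + th2 r * G 2%nat r) /\
    is_derive (G 1%nat) r (- th1 r * G 0%nat r + q r * th2 r * G 2%nat r + tau r * th2 r * G 3%nat r) /\
    is_derive (G 2%nat) r (- th2 r * G 0%nat r - q r * th2 r * G 1%nat r + tau r * th1 r * G 3%nat r) /\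
    is_derive (G 3%nat) r (- tau r * th2 r * G 1%nat r - tau r * th1 r * G 2%nat r).
Proof.
  intros Hr.
  assert (HdT := HT r Hr). assert (HdS := HS r Hr).
  destruct (lawson_tau_q r Hr) as [Et Eq].
  assert (HG := inv_sqrt_sqr _ (lawson_G_pos alpha (S r) Ha)).
  unfold lawson_frame. unfold lawson_G in HG at 3.
  set (g := fun r => / sqrt (lawson_G alpha (S r))).
  assert (Hdg : is_derive g r (- q r * th1 r * g r)) by exact (is_derive_inv_sqrt_G r Hr).
  change (/ sqrt (lawson_G alpha (S r))) with (g r) in *.
  cut (let G k r := dot4 a (lawson_frame_scaled alpha (g r) (S r) (T r) k) in
    is_derive (G 0%nat) r (th1 r * G 1%nat r + th2 r * G 2%nat r) /\
    is_derive (G 1%nat) r (- th1 r * G 0%nat r + q r * th2 r * G 2%nat r + tau r * th2 r * G 3%nat r) /\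
    is_derive (G 2%nat) r (- th2 r * G 0%nat r - q r * th2 r * G 1%nat r + tau r * th1 r * G 3%nat r) /\
    is_derive (G 3%nat) r (- tau r * th2 r * G 1%nat r - tau r * th1 r * G 2%nat r));
    [intros H; exact H|].
  clearbody g. unfold lawson_frame_scaled, lawson, dot4. cbv zeta.
  assert (Hs : sin (S r) * sin (S r) = 1 - cos (S r) * cos (S r)).
  { assert (H := sin2_cos2 (S r)). unfold Rsqr in H. lra. }
  (* The normalization [g^2 G = 1] solved for its monomial in [alpha^2], so that [ring] can use it
     as a rewriting rule. *)
  assert (Hg : g r * g r * alpha * alpha * cos (S r) * cos (S r)
     = 1 - g r * g r + g r * g r * cos (S r) * cos (S r)).
  { rewrite <- HG at 1. ring [Hs]. }
  split; [|split; [|split]];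
    (auto_derive; [repeat split; eexists; eassumption |
     rewrite ?(Derive_eta _ _ _ HdS), ?(Derive_eta _ _ _ HdT), ?(Derive_eta _ _ _ Hdg), ?Eq, ?Et;
     ring [Hs Hg]]).
Qed.

End LawsonCurve.

(** * Ruled frames come from Lawson tori *)

Lemma polar_angle x y : x ^ 2 + y ^ 2 = 1 -> exists th, cos th = x /\ sin th = y.
Proof.
  intros H. assert (Hx : -1 <= x <= 1) by nra.
  assert (Hs : sin (acos x) = sqrt (1 - x ^ 2)).
  { rewrite sin_acos by assumption. f_equal. unfold Rsqr. ring. }
  replace (1 - x ^ 2) with (y * y) in Hs by lra.
  change (y * y) with (Rsqr y) in Hs. rewrite sqrt_Rsqr_abs in Hs.
  destruct (Rle_lt_dec 0 y) as [Hy|Hy].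
  - exists (acos x). split; [now apply cos_acos|]. now rewrite Hs, Rabs_pos_eq.
  - exists (- acos x). rewrite cos_neg, sin_neg. split; [now apply cos_acos|].
    rewrite Hs, Rabs_left by assumption. ring.
Qed.

Lemma antiderivative (f : R -> R) lo hi r1 z :
  (forall r, lo < r < hi -> continuous f r) -> lo < r1 < hi ->
  exists F : R -> R, F r1 = z /\ forall r, lo < r < hi -> is_derive F r (f r).
Proof.
  intros Hf Hr1. exists (fun r => z + RInt f r1 r). split.
  - rewrite RInt_point. unfold zero; simpl. ring.
  - intros r Hr. rewrite <- (Rplus_0_l (f r)).
    apply (is_derive_plus (fun _ => z)); [apply (is_derive_const z)|].
    apply (is_derive_RInt f (RInt f r1) r1 r); [|now apply Hf].
    assert (Hd : 0 < Rmin (r - lo) (hi - r)) by (apply Rmin_glb_lt; lra).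
    assert (Hb : forall p : R, Rabs (p - r) < Rmin (r - lo) (hi - r) -> is_RInt f r1 p (RInt f r1 p)).
    { intros p Hp. apply (RInt_correct f), (ex_RInt_continuous f).
      assert (M1 := Rmin_l (r - lo) (hi - r)). assert (M2 := Rmin_r (r - lo) (hi - r)).
      apply Rabs_lt_between in Hp.
      intros t Ht. apply Hf. unfold Rmin, Rmax in Ht. destruct (Rle_dec r1 p); lra. }
    exists (mkposreal _ Hd). exact Hb.
Qed.

Section LawsonOfFrame.
Variables (U : R -> R -> Prop) (e : nat -> surf) (w1 w2 : bool -> R -> R -> R)
  (q tau : R -> R -> R).
Hypothesis HU : open2 U.
Hypothesis HUc : connected2 U.
Hypothesis He : forall k, (k < 4)%nat -> smv U (e k).
Hypothesis Hw1 : forall b, smooth_on U (w1 b).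
Hypothesis Hw2 : forall b, smooth_on U (w2 b).
Hypothesis Hq : smooth_on U q.
Hypothesis Htau : smooth_on U tau.
Hypothesis Ho : forall x y, U x y -> orthonormal (frame_at e x y).
Hypothesis Hfr : ruled_frame U e w1 w2 q tau.
Hypothesis Htau0 : forall x y, U x y -> 0 < tau x y.

Lemma frame_slice b x y r : slice b U x y r ->
  (forall i, (i < 4)%nat ->
    let E k := slice b (e k i) x y in
    let th1 := slice b (w1 b) x y r in let th2 := slice b (w2 b) x y r in
    let qs := slice b q x y r in let ts := slice b tau x y r in
    is_derive (E 0%nat) r (th1 * E 1%nat r + th2 * E 2%nat r) /\
    is_derive (E 1%nat) r (- th1 * E 0%nat r + qs * th2 * E 2%nat r + ts * th2 * E 3%nat r) /\
    is_derive (E 2%nat) r (- th2 * E 0%nat r - qs * th2 * E 1%nat r + ts * th1 * E 3%nat r) /\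
    is_derive (E 3%nat) r (- ts * th2 * E 1%nat r - ts * th1 * E 2%nat r)) /\
  is_derive (slice b tau x y) r
    (- 2 * slice b q x y r * slice b tau x y r * slice b (w1 b) x y r) /\
  is_derive (slice b q x y) r
    ((slice b tau x y r ^ 2 - 1 - slice b q x y r ^ 2) * slice b (w1 b) x y r).
Proof.
  intros Hr.
  assert (Hs : forall g, smooth_on U g ->
    is_derive (slice b g x y) r (slice b (pd b g) x y r))
    by (intros; now apply smooth_slice with U).
  assert (HT := Hs _ Htau). assert (HQ := Hs _ Hq).
  destruct b; cbn [slice] in *;
    [destruct (Hfr true r y Hr) as [H1 [H2 H3]] | destruct (Hfr false x r Hr) as [H1 [H2 H3]]];
    (split; [|rewrite <- H2, <- H3; split; assumption]);
    intros i Hi; destruct (H1 i Hi) as [E0 [E1 [E2 E3]]];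
    rewrite <- E0, <- E1, <- E2, <- E3;
    (split; [|split; [|split]]); apply Hs, He; (assumption || lia).
Qed.

Definition ruled_invariant x y : R := (q x y ^ 2 + 1 + tau x y ^ 2) / tau x y.

Lemma ruled_invariant_constant x0 y0 : U x0 y0 ->
  forall x y, U x y -> ruled_invariant x y = ruled_invariant x0 y0.
Proof.
  intros H0. apply (connected_constant U ruled_invariant x0 y0); auto.
  intros b x y Hxy.
  assert (Hb : slice b U x y (coord b x y)) by (destruct b; exact Hxy).
  destruct (frame_slice b x y _ Hb) as [_ [HT HQ]].
  assert (Hp : 0 < slice b tau x y (coord b x y)) by (rewrite slice_coord; now apply Htau0).
  pose (Q := slice b q x y : R -> R). pose (T := slice b tau x y : R -> R).
  pose (th := slice b (w1 b) x y (coord b x y) : R). set (p := coord b x y) in *.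
  change (is_derive T p (- 2 * Q p * T p * th)) in HT.
  change (is_derive Q p ((T p ^ 2 - 1 - Q p ^ 2) * th)) in HQ.
  change (0 < T p) in Hp.
  cut (is_derive (fun t => (Q t ^ 2 + 1 + T t ^ 2) / T t) p 0);
    [intros H; destruct b; exact H|].
  clearbody Q T th p.
  auto_derive.
  - repeat split; try lra; eexists; eassumption.
  - rewrite (Derive_eta _ _ _ HT), (Derive_eta _ _ _ HQ). field. lra.
Qed.

Lemma lawson_of_ruled_frame x0 y0 : U x0 y0 -> q x0 y0 <> 0 \/ tau x0 y0 <> 1 ->
  exists alpha, 1 < alpha /\ exists A, orthogonal4 A /\
    forall x y, U x y -> exists s t,
      forall i, (i < 4)%nat -> e 0%nat i x y = mat_app A (lawson alpha s t) i.
Proof.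
  intros H0 Hne.
  set (C := ruled_invariant x0 y0).
  assert (HCeq : forall x y, U x y -> q x y ^ 2 + 1 + tau x y ^ 2 = C * tau x y).
  { intros x y Hxy. unfold C. rewrite <- (ruled_invariant_constant x0 y0 H0 x y Hxy).
    unfold ruled_invariant. assert (Hp := Htau0 x y Hxy). field. lra. }
  (* [(C - 2) tau = q^2 + (tau - 1)^2], and one of the squares is positive at the base point. *)
  assert (HC2 : 2 < C).
  { assert (Hp := Htau0 x0 y0 H0). assert (HC0 := HCeq x0 y0 H0).
    assert (0 < q x0 y0 ^ 2 + (tau x0 y0 - 1) ^ 2).
    { assert (S1 := pow2_ge_0 (q x0 y0)). assert (S2 := pow2_ge_0 (tau x0 y0 - 1)).
      destruct Hne as [Hne|Hne].
      - assert (0 < q x0 y0 ^ 2) by (apply pow2_gt_0; assumption). lra.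
      - assert (0 < (tau x0 y0 - 1) ^ 2) by (apply pow2_gt_0; lra). lra. }
    nra. }
  (* The larger root of [X^2 - C X + 1]. The other root [/ alpha] describes the same torus up to a
     permutation of the coordinates and a change of parameters. *)
  set (alpha := (C + sqrt (C ^ 2 - 4)) / 2).
  assert (Hsq : sqrt (C ^ 2 - 4) * sqrt (C ^ 2 - 4) = C ^ 2 - 4) by (apply sqrt_sqrt; nra).
  assert (Hsp : 0 <= sqrt (C ^ 2 - 4)) by apply sqrt_pos.
  assert (Ha : 1 < alpha) by (unfold alpha; lra).
  assert (HaC : alpha + / alpha = C).
  { apply Rmult_eq_reg_r with alpha; [|lra].
    rewrite Rmult_plus_distr_r, Rinv_l by lra. unfold alpha. nra. }
  set (rho := (alpha - / alpha) / 2).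
  assert (Hrho : 0 < rho).
  { unfold rho. assert (/ alpha < 1) by (rewrite <- Rinv_1; apply Rinv_lt_contravar; lra). lra. }
  assert (Hrho2 : rho ^ 2 = C ^ 2 / 4 - 1) by (unfold rho; rewrite <- HaC; field; lra).
  exists alpha. split; [exact Ha|].
  (* The pair [(/ tau - C / 2, - q / tau)] lies on the circle of radius [rho], because
     [rho^2 = C^2 / 4 - 1]; half its polar angle is the parameter [s0]. *)
  assert (Hs0 : exists s0, / tau x0 y0 - C / 2 = rho * cos (2 * s0) /\
     q x0 y0 / tau x0 y0 = - rho * sin (2 * s0)).
  { assert (Hp := Htau0 x0 y0 H0). assert (HC0 := HCeq x0 y0 H0).
    destruct (polar_angle ((/ tau x0 y0 - C / 2) / rho) (- (q x0 y0 / tau x0 y0) / rho))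
      as [th [Hc Hs]].
    - transitivity (((/ tau x0 y0 - C / 2) ^ 2 + (q x0 y0 / tau x0 y0) ^ 2) / rho ^ 2);
        [field; lra|].
      rewrite Hrho2.
      replace ((/ tau x0 y0 - C / 2) ^ 2 + (q x0 y0 / tau x0 y0) ^ 2)
        with ((q x0 y0 ^ 2 + 1 - C * tau x0 y0) / tau x0 y0 ^ 2 + C ^ 2 / 4) by (field; lra).
      replace (q x0 y0 ^ 2 + 1 - C * tau x0 y0) with (- tau x0 y0 ^ 2) by lra.
      field. split; nra.
    - exists (th / 2). replace (2 * (th / 2)) with th by field.
      rewrite Hc, Hs. split; field; lra. }
  destruct Hs0 as [s0 [Hu0 Hv0]].
  (* The matrix carrying the Lawson frame at [(s0, 0)] to the frame of the surface at the base
     point. The choice of 0 for the second parameter is free, since a shift of [t] acts by rotations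
     in two coordinate planes. *)
  set (A := fun i j => dot4 (fun k => e k i x0 y0) (fun k => lawson_frame alpha s0 0 k j)).
  assert (HL0 := lawson_frame_orthonormal alpha s0 0 Ha).
  assert (HA : forall k i, (k < 4)%nat -> (i < 4)%nat ->
    e k i x0 y0 = mat_app A (lawson_frame alpha s0 0 k) i).
  { intros k i Hk Hi. unfold mat_app.
    transitivity (dot4 (fun m => e m i x0 y0)
      (fun m => dot4 (lawson_frame alpha s0 0 m) (lawson_frame alpha s0 0 k))).
    - transitivity (dot4 (fun m => e m i x0 y0) (fun m => kron m k)).
      + rewrite (dot4_kron (fun m => e m i x0 y0)); auto.
      + apply dot4_ext; auto. intros m Hm. symmetry. now apply HL0.
    - unfold A, dot4. ring. }
  exists A. split.
  { assert (HLt := orthonormal_transpose _ HL0).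
    assert (Hot := Ho x0 y0 H0).
    intros j k Hj Hk. change (if Nat.eqb j k then 1 else 0) with (kron j k).
    rewrite <- (HLt j k Hj Hk).
    transitivity (dot4 (fun m => lawson_frame alpha s0 0 m j)
      (fun m => dot4 (fun n => dot4 (frame_at e x0 y0 m) (frame_at e x0 y0 n))
                     (fun n => lawson_frame alpha s0 0 n k))).
    - unfold A, frame_at, pt, dot4. ring.
    - apply dot4_ext; auto. intros m Hm.
      transitivity (dot4 (fun n => lawson_frame alpha s0 0 n k) (fun n => kron n m)).
      + unfold dot4 at 1. rewrite !Hot by (assumption || lia).
        rewrite !(kron_sym m). unfold dot4. ring.
      + now rewrite dot4_kron. }
  (* Matching covers [tau] and [q] besides the frame: these are the coefficients of the frame
     equations, so they must agree for uniqueness to apply along the next segment. *)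
  set (W := fun x y => exists s t,
    (/ tau x y - C / 2 = rho * cos (2 * s) /\ q x y / tau x y = - rho * sin (2 * s)) /\
    forall k i, (k < 4)%nat -> (i < 4)%nat ->
      e k i x y = mat_app A (lawson_frame alpha s t k) i).
  enough (HW : forall x y, U x y -> W x y).
  { intros x y Hxy. destruct (HW x y Hxy) as [s [t [_ H]]].
    exists s, t. intros i Hi. now apply (H 0%nat i); [lia|]. }
  apply (connected_by_segments U W x0 y0); auto.
  2:{ exists s0, 0. auto. }
  clearbody A. clear s0 Hu0 Hv0 HL0 HA.
  intros b x y lo hi r1 r2 HUs Hr1 Hr2 HW.
  assert (HW1 : exists s t,
    (/ slice b tau x y r1 - C / 2 = rho * cos (2 * s) /\
     slice b q x y r1 / slice b tau x y r1 = - rho * sin (2 * s)) /\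
    forall k i, (k < 4)%nat -> (i < 4)%nat ->
      slice b (e k i) x y r1 = mat_app A (lawson_frame alpha s t k) i)
    by (destruct b; exact HW).
  cut (exists s t,
    (/ slice b tau x y r2 - C / 2 = rho * cos (2 * s) /\
     slice b q x y r2 / slice b tau x y r2 = - rho * sin (2 * s)) /\
    forall k i, (k < 4)%nat -> (i < 4)%nat ->
      slice b (e k i) x y r2 = mat_app A (lawson_frame alpha s t k) i).
  { intros H. destruct b; exact H. }
  clear HW. clearbody alpha. clearbody C. subst C.
  destruct HW1 as [s1 [t1 [[Hu1 Hv1] HF1]]].
  assert (Hcont : forall g r, smooth_on U g -> lo < r < hi -> continuous (slice b g x y) r).
  { intros g r Hg Hr. apply smooth_slice_continuous with U; auto. }
  (* [S] and [T] are the torus parameters along this segment, starting from the values that match at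
     [r1]. *)
  destruct (antiderivative (slice b (w1 b) x y) lo hi r1 s1) as [S [HS1 HS]]; auto.
  destruct (antiderivative (fun r => slice b (w2 b) x y r * / sqrt (lawson_G alpha (S r)))
    lo hi r1 t1) as [T [HT1 HT]]; auto.
  { intros r Hr. apply (continuous_mult (slice b (w2 b) x y)); [now apply Hcont|].
    assert (HGp := lawson_G_pos alpha (S r) Ha). assert (Hsg := sqrt_lt_R0 _ HGp).
    apply (ex_derive_continuous (fun r => / sqrt (lawson_G alpha (S r)))).
    unfold lawson_G in *. simpl in HGp, Hsg. auto_derive.
    repeat split; try lra; eexists; now apply HS. }
  assert (Htau0' : forall r, lo < r < hi -> 0 < slice b tau x y r)
    by (intros r Hr; assert (Hb := HUs r Hr); destruct b; now apply Htau0).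
  assert (HC' : forall r, lo < r < hi ->
    slice b q x y r ^ 2 + 1 + slice b tau x y r ^ 2 = (alpha + / alpha) * slice b tau x y r)
    by (intros r Hr; assert (Hb := HUs r Hr); destruct b; now apply HCeq).
  assert (Htau' := fun r Hr => proj1 (proj2 (frame_slice b x y r (HUs r Hr)))).
  assert (Hq' := fun r Hr => proj2 (proj2 (frame_slice b x y r (HUs r Hr)))).
  assert (HF' := fun r Hr => proj1 (frame_slice b x y r (HUs r Hr))).
  rewrite <- HS1 in Hu1, Hv1.
  exists (S r2), (T r2). split.
  { apply (lawson_invariants alpha lo hi r1 (slice b (w1 b) x y) (slice b q x y)
      (slice b tau x y) S); auto. }
  intros k i Hk Hi.
  assert (HG := lawson_row_ode alpha lo hi r1 (slice b (w1 b) x y) (slice b (w2 b) x y)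
    (slice b q x y) (slice b tau x y) S T Ha Hr1 HS HT Htau0' HC' Htau' Hq' Hu1 Hv1 (A i)).
  destruct (skew_ode_unique lo hi r1 r2 _ _ _ _ _ _ _ _ _ _ _ _
    (fun r Hr => HF' r Hr i Hi) HG Hr1 Hr2) as [R0 [R1 [R2 R3]]];
    try (rewrite HS1, HT1; apply HF1; (assumption || lia)).
  unfold mat_app. nat4 k Hk; assumption.
Qed.

End LawsonOfFrame.

(** * The frame of a generalized torus *)

(** The triple vector product of four-space, made of signed minors; its squared length is the Gram
    determinant of the three vectors. *)
Definition cross4 (u v w : vec4) : vec4 := fun i =>
  match i with
  | 0%nat => - det3 (u 1%nat) (u 2%nat) (u 3%nat) (v 1%nat) (v 2%nat) (v 3%nat)
                    (w 1%nat) (w 2%nat) (w 3%nat)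
  | 1%nat => det3 (u 0%nat) (u 2%nat) (u 3%nat) (v 0%nat) (v 2%nat) (v 3%nat)
                  (w 0%nat) (w 2%nat) (w 3%nat)
  | 2%nat => - det3 (u 0%nat) (u 1%nat) (u 3%nat) (v 0%nat) (v 1%nat) (v 3%nat)
                    (w 0%nat) (w 1%nat) (w 3%nat)
  | _ => det3 (u 0%nat) (u 1%nat) (u 2%nat) (v 0%nat) (v 1%nat) (v 2%nat)
              (w 0%nat) (w 1%nat) (w 2%nat)
  end.

Lemma cross4_perp u v w :
  dot4 (cross4 u v w) u = 0 /\ dot4 (cross4 u v w) v = 0 /\ dot4 (cross4 u v w) w = 0.
Proof. unfold dot4, cross4, det3. repeat split; ring. Qed.

Lemma cross4_norm u v w : dot4 (cross4 u v w) (cross4 u v w) =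
  det3 (dot4 u u) (dot4 u v) (dot4 u w) (dot4 u v) (dot4 v v) (dot4 v w)
       (dot4 u w) (dot4 v w) (dot4 w w).
Proof. unfold dot4, cross4, det3. ring. Qed.

(* (c, d) completes (a, b) to an orthonormal basis of the metric [E F; F G]. *)
Lemma orthonormal_completion E F G a b :
  0 < E * G - F ^ 2 -> a * a * E + (a * b + b * a) * F + b * b * G = 1 ->
  let g := / sqrt (E * G - F ^ 2) in
  let c := - (a * F + b * G) * g in let d := (a * E + b * F) * g in
  (a * c * E + (a * d + b * c) * F + b * d * G = 0 /\
   c * c * E + (c * d + d * c) * F + d * d * G = 1) /\
  (a * (a * E + b * F) + c * (c * E + d * F) = 1 /\
   b * (a * E + b * F) + d * (c * E + d * F) = 0 /\
   a * (a * F + b * G) + c * (c * F + d * G) = 0 /\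
   b * (a * F + b * G) + d * (c * F + d * G) = 1) /\
  (a * a + c * c) * (E * G - F ^ 2) = G /\
  (a * b + c * d) * (E * G - F ^ 2) = - F /\
  (b * b + d * d) * (E * G - F ^ 2) = E.
Proof.
  intros HD Hu g c d.
  assert (Hg := inv_sqrt_sqr _ HD). fold g in Hg. clearbody g.
  assert (Hu' : a * a * E = 1 - 2 * a * b * F - b * b * G) by lra.
  (* The three identities say that the sum of [v v^T] over an orthonormal basis is the inverse
     matrix of the metric. *)
  assert (R1 : (a * a + c * c) * (E * G - F ^ 2) = G).
  { transitivity (a * a * (E * G - F ^ 2) + (a * F + b * G) ^ 2 * (g * g * (E * G - F ^ 2)));
      [unfold c; ring|]. rewrite Hg. ring [Hu']. }
  assert (R2 : (a * b + c * d) * (E * G - F ^ 2) = - F).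
  { transitivity (a * b * (E * G - F ^ 2)
      - (a * F + b * G) * (a * E + b * F) * (g * g * (E * G - F ^ 2)));
      [unfold c, d; ring|]. rewrite Hg. ring [Hu']. }
  assert (R3 : (b * b + d * d) * (E * G - F ^ 2) = E).
  { transitivity (b * b * (E * G - F ^ 2) + (a * E + b * F) ^ 2 * (g * g * (E * G - F ^ 2)));
      [unfold d; ring|]. rewrite Hg. ring [Hu']. }
  assert (HD0 : E * G - F ^ 2 <> 0) by lra.
  split; [split|split; [split; [|split; [|split]]|auto]].
  - unfold c, d; ring.
  - transitivity ((a * a * E + (a * b + b * a) * F + b * b * G) * (g * g * (E * G - F ^ 2)));
      [unfold c, d; ring | rewrite Hu, Hg; ring].
  - apply Rmult_eq_reg_r with (E * G - F ^ 2); [|exact HD0].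
    transitivity ((a * a + c * c) * (E * G - F ^ 2) * E + (a * b + c * d) * (E * G - F ^ 2) * F);
      [ring | rewrite R1, R2; ring].
  - apply Rmult_eq_reg_r with (E * G - F ^ 2); [|exact HD0].
    transitivity ((a * b + c * d) * (E * G - F ^ 2) * E + (b * b + d * d) * (E * G - F ^ 2) * F);
      [ring | rewrite R2, R3; ring].
  - apply Rmult_eq_reg_r with (E * G - F ^ 2); [|exact HD0].
    transitivity ((a * a + c * c) * (E * G - F ^ 2) * F + (a * b + c * d) * (E * G - F ^ 2) * G);
      [ring | rewrite R1, R2; ring].
  - apply Rmult_eq_reg_r with (E * G - F ^ 2); [|exact HD0].
    transitivity ((a * b + c * d) * (E * G - F ^ 2) * F + (b * b + d * d) * (E * G - F ^ 2) * G);
      [ring | rewrite R2, R3; ring].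
Qed.

(* Here [mu sg; sg -mu] is the second form in the basis (bisectrix, its orthogonal), and the
   conclusion says that the bisectrix is asymptotic. *)
Lemma traceless_bisectrix mu sg :
  (forall lam p1 p2, (p1 <> 0 \/ p2 <> 0) ->
     mu * p1 + sg * p2 = lam * p1 -> sg * p1 - mu * p2 = lam * p2 ->
     p1 ^ 2 = / 2 * (p1 ^ 2 + p2 ^ 2)) ->
  mu = 0.
Proof.
  intros H. set (lam := sqrt (mu ^ 2 + sg ^ 2)).
  assert (Hl : lam * lam = mu ^ 2 + sg ^ 2).
  { apply sqrt_sqrt. assert (S1 := pow2_ge_0 mu). assert (S2 := pow2_ge_0 sg). lra. }
  assert (Hl0 : 0 <= lam) by apply sqrt_pos.
  destruct (Req_dec mu 0) as [H0|H0]; [assumption|exfalso].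
  assert (Hmu2 : 0 < mu ^ 2) by now apply pow2_gt_0.
  assert (Hsg2 := pow2_ge_0 sg).
  assert (Hlp : 0 < lam) by nra.
  (* [(lam + mu, sg)] and [(sg, lam - mu)] are both eigenvectors for [lam]. The sign of [mu] decides
     which of them is certainly nonzero. *)
  destruct (Rlt_le_dec 0 mu) as [Hmu|Hmu].
  - specialize (H lam (lam + mu) sg ltac:(left; lra) ltac:(lra) ltac:(lra)). nra.
  - specialize (H lam sg (lam - mu) ltac:(right; lra) ltac:(lra) ltac:(lra)). nra.
Qed.

Section TorusFrame.
Variables (U : R -> R -> Prop) (f : surf) (a b : R -> R -> R).
Hypothesis HU : open2 U.
Hypothesis Hf : smv U f.
Hypothesis Hsphere : forall x y, U x y ->
  dot4 (pt f x y) (pt f x y) = 1 /\ EE f x y * GG f x y - FF f x y ^ 2 > 0.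
Hypothesis Hmin : minimal_in_S3 U f.
Hypothesis Humb : no_umbilics U f.
Hypothesis Hsa : smooth_on U a.
Hypothesis Hsb : smooth_on U b.
Hypothesis Hbis : forall x y, U x y ->
  Iform f x y (a x y) (b x y) (a x y) (b x y) = 1 /\ bisectrix_dir f x y (a x y) (b x y).

Definition area_inv : R -> R -> R := fun x y => / sqrt (EE f x y * GG f x y - FF f x y * FF f x y).
Definition cc : R -> R -> R := fun x y => - (a x y * FF f x y + b x y * GG f x y) * area_inv x y.
Definition dd : R -> R -> R := fun x y => (a x y * EE f x y + b x y * FF f x y) * area_inv x y.
Definition tangent (p r : R -> R -> R) : surf :=
  fun i x y => p x y * pd true (f i) x y + r x y * pd false (f i) x y.
Definition fr (k : nat) : surf :=
  match k with
  | 0%nat => f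
  | 1%nat => tangent a b
  | 2%nat => tangent cc dd
  | _ => fun i x y => cross4 (pt f x y) (pt (tangent a b) x y) (pt (tangent cc dd) x y) i
  end.

Lemma smooth_EE : smooth_on U (EE f).
Proof. apply (smooth_dotf U (pdv true f) (pdv true f)); auto; now apply smooth_pdv. Qed.
Lemma smooth_FF : smooth_on U (FF f).
Proof. apply (smooth_dotf U (pdv true f) (pdv false f)); auto; now apply smooth_pdv. Qed.
Lemma smooth_GG : smooth_on U (GG f).
Proof. apply (smooth_dotf U (pdv false f) (pdv false f)); auto; now apply smooth_pdv. Qed.

Lemma smooth_area_inv : smooth_on U area_inv.
Proof.
  assert (HE := smooth_EE). assert (HF := smooth_FF). assert (HG := smooth_GG).
  apply (smooth_inv_sqrt U (fun x y => EE f x y * GG f x y - FF f x y * FF f x y)); auto.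
  - smooth.
  - intros x y Hxy. destruct (Hsphere x y Hxy) as [_ H]. lra.
Qed.

Lemma smooth_cc : smooth_on U cc.
Proof.
  assert (HE := smooth_EE). assert (HF := smooth_FF). assert (HG := smooth_GG).
  assert (HA := smooth_area_inv). unfold cc. smooth.
Qed.

Lemma smooth_dd : smooth_on U dd.
Proof.
  assert (HE := smooth_EE). assert (HF := smooth_FF). assert (HG := smooth_GG).
  assert (HA := smooth_area_inv). unfold dd. smooth.
Qed.

Lemma smooth_tangent p r : smooth_on U p -> smooth_on U r -> smv U (tangent p r).
Proof.
  intros Hp Hr i Hi. unfold tangent.
  assert (H1 : smooth_on U (pd true (f i))) by now apply smooth_pd, Hf.
  assert (H2 : smooth_on U (pd false (f i))) by now apply smooth_pd, Hf.
  smooth.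
Qed.

Lemma smooth_fr k : (k < 4)%nat -> smv U (fr k).
Proof.
  intros Hk.
  assert (H1 := smooth_tangent a b Hsa Hsb).
  assert (H2 := smooth_tangent cc dd smooth_cc smooth_dd).
  nat4 k Hk; simpl; auto.
  set (t1 := tangent a b) in *. set (t2 := tangent cc dd) in *. clearbody t1 t2.
  intros i Hi. unfold pt. nat4 i Hi; simpl; unfold det3; smooth.
Qed.

Lemma metric_completion x y : U x y ->
  let A := a x y in let B := b x y in let C := cc x y in let D := dd x y in
  let E := EE f x y in let F := FF f x y in let G := GG f x y in
  A * A * E + (A * B + B * A) * F + B * B * G = 1 /\
  (A * C * E + (A * D + B * C) * F + B * D * G = 0 /\
   C * C * E + (C * D + D * C) * F + D * D * G = 1) /\
  (A * (A * E + B * F) + C * (C * E + D * F) = 1 /\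
   B * (A * E + B * F) + D * (C * E + D * F) = 0 /\
   A * (A * F + B * G) + C * (C * F + D * G) = 0 /\
   B * (A * F + B * G) + D * (C * F + D * G) = 1) /\
  (A * A + C * C) * (E * G - F ^ 2) = G /\
  (A * B + C * D) * (E * G - F ^ 2) = - F /\
  (B * B + D * D) * (E * G - F ^ 2) = E.
Proof.
  intros Hxy. destruct (Hsphere x y Hxy) as [_ HD]. destruct (Hbis x y Hxy) as [Hu _].
  unfold Iform in Hu. split; [exact Hu|].
  assert (H := orthonormal_completion _ _ _ _ _ HD Hu).
  replace (EE f x y * GG f x y - FF f x y ^ 2)
    with (EE f x y * GG f x y - FF f x y * FF f x y) in * by ring.
  exact H.
Qed.

Lemma pos_perp c x y : U x y -> dotf f (pdv c f) x y = 0.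
Proof.
  intros Hxy. assert (H := pd_dotf U c f f x y HU Hf Hf Hxy).
  rewrite (pd_ext U (dotf f f) (fun _ _ => 1)), pd_const in H; auto.
  - rewrite (dotf_sym (pdv c f)) in H. lra.
  - intros u v Huv. now apply Hsphere.
Qed.

Lemma dot_pos_tangent p r x y : U x y -> dot4 (pt f x y) (pt (tangent p r) x y) = 0.
Proof.
  intros Hxy.
  transitivity (p x y * dotf f (pdv true f) x y + r x y * dotf f (pdv false f) x y).
  - unfold tangent, dotf, dot4, pt, pdv. ring.
  - rewrite !pos_perp by assumption. ring.
Qed.

Lemma dot_tangent p r p' r' x y :
  dot4 (pt (tangent p r) x y) (pt (tangent p' r') x y) =
  Iform f x y (p x y) (r x y) (p' x y) (r' x y).
Proof.
  unfold Iform, EE, FF, GG, tangent, dot4, pt, fx, fy, pd. ring.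
Qed.

Lemma fr_orthonormal x y : U x y -> orthonormal (frame_at fr x y).
Proof.
  intros Hxy.
  destruct (metric_completion x y Hxy) as [M0 [[M1 M2] _]].
  destruct (Hsphere x y Hxy) as [H00 _].
  assert (H01 := dot_pos_tangent a b x y Hxy).
  assert (H02 := dot_pos_tangent cc dd x y Hxy).
  assert (H11 := dot_tangent a b a b x y). assert (H12 := dot_tangent a b cc dd x y).
  assert (H22 := dot_tangent cc dd cc dd x y).
  unfold Iform in H11, H12, H22. rewrite M0 in H11. rewrite M1 in H12. rewrite M2 in H22.
  assert (Hc := cross4_perp (pt f x y) (pt (tangent a b) x y) (pt (tangent cc dd) x y)).
  destruct Hc as [H30 [H31 H32]].
  assert (H33 := cross4_norm (pt f x y) (pt (tangent a b) x y) (pt (tangent cc dd) x y)).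
  rewrite H00, H01, H02, H11, H12, H22 in H33. unfold det3 in H33.
  assert (Hsym : forall u v, dot4 u v = dot4 v u) by (intros; unfold dot4; ring).
  assert (H : forall j k, (j <= k)%nat -> (k < 4)%nat ->
    dot4 (frame_at fr x y j) (frame_at fr x y k) = kron j k).
  { intros j k Hjk Hk. nat4 k Hk; nat4 j Hjk; try (exfalso; lia);
      unfold kron; simpl; try assumption;
      try (rewrite Hsym; assumption). rewrite <- (Rplus_0_l 1).
    transitivity (dot4 (cross4 (pt f x y) (pt (tangent a b) x y) (pt (tangent cc dd) x y))
      (cross4 (pt f x y) (pt (tangent a b) x y) (pt (tangent cc dd) x y))); [reflexivity|].
    rewrite H33. ring. }
  intros j k Hj Hk. destruct (Nat.le_ge_cases j k); [auto|].
  rewrite Hsym, kron_sym. auto.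
Qed.

Lemma fr3_unit_normal x y : U x y -> unit_normal f x y (pt (fr 3) x y).
Proof.
  intros Hxy. assert (Ho := fr_orthonormal x y Hxy).
  split; [exact (Ho 3%nat 3%nat ltac:(lia) ltac:(lia))|].
  split; [exact (Ho 3%nat 0%nat ltac:(lia) ltac:(lia))|].
  unfold fr, cross4, det3, tangent, fx, fy, pt, dot4, pd. split; ring.
Qed.

Lemma dot_pd_tangent p r c x y : dotf (pdv c f) (tangent p r) x y =
  if c then p x y * EE f x y + r x y * FF f x y else p x y * FF f x y + r x y * GG f x y.
Proof.
  unfold dotf, tangent, pdv, EE, FF, GG, fx, fy, pt, dot4, pd. destruct c; ring.
Qed.

Lemma dot_pd_normal c x y : U x y -> dotf (pdv c f) (fr 3) x y = 0.
Proof.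
  intros Hxy. destruct (fr3_unit_normal x y Hxy) as [_ [_ [H1 H2]]].
  rewrite dotf_sym. destruct c; assumption.
Qed.

(** Derivatives of the coefficients [p], [r] multiply tangent vectors and drop out against the
    normal, so only second derivatives of the position remain. *)
Lemma pd_tangent_normal p r c x y : smooth_on U p -> smooth_on U r -> U x y ->
  let n := pt (fr 3) x y in
  dotf (pdv c (tangent p r)) (fr 3) x y =
  if c then p x y * LL f x y n + r x y * MM f x y n
  else p x y * MM f x y n + r x y * NN f x y n.
Proof.
  intros Hp Hr Hxy n.
  assert (Hpd : forall i, (i < 4)%nat -> pdv c (tangent p r) i x y
    = pd c p x y * pd true (f i) x y + pd c r x y * pd false (f i) x y
      + (p x y * pd c (pd true (f i)) x y + r x y * pd c (pd false (f i)) x y)).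
  { intros i Hi. unfold pdv, tangent.
    assert (H1 : smooth_on U (pd true (f i))) by now apply smooth_pd, Hf.
    assert (H2 : smooth_on U (pd false (f i))) by now apply smooth_pd, Hf.
    rewrite (pd_plus U c (fun x y => p x y * pd true (f i) x y)
      (fun x y => r x y * pd false (f i) x y)); [|smooth|smooth|assumption].
    rewrite (pd_mult U c p), (pd_mult U c r) by assumption. ring. }
  transitivity (pd c p x y * dotf (pdv true f) (fr 3) x y
    + pd c r x y * dotf (pdv false f) (fr 3) x y
    + (p x y * dotf (pdv c (pdv true f)) (fr 3) x y
       + r x y * dotf (pdv c (pdv false f)) (fr 3) x y)).
  - unfold dotf at 1. unfold dot4, pt at 1 3 5 7. rewrite !Hpd by lia.
    unfold dotf, dot4, pt, pdv. ring.
  - rewrite !dot_pd_normal by assumption.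
    assert (Hc : dotf (pdv true (pdv false f)) (fr 3) x y = MM f x y n).
    { unfold MM, dotf. apply dot4_ext; auto. intros i Hi.
      exact (pd_comm U true false (f i) x y HU (Hf i Hi) Hxy). }
    destruct c.
    + rewrite Hc. unfold LL, n, dotf, fxx, pdv, pt, pd. ring.
    + unfold MM, NN, n, dotf, fxy, fyy, pdv, pt, pd. ring.
Qed.

(** The form [om fr 1 3] evaluated on [e2], that is, the off-diagonal entry of the second form. *)
Definition tau : R -> R -> R := fun x y =>
  cc x y * om fr 1 3 true x y + dd x y * om fr 1 3 false x y.

(** In the orthonormal basis of the bisectrix and its orthogonal the second form has diagonal [mu],
    [nu] and off-diagonal entry [sg]. Minimality gives [nu = - mu], the bisectrix property gives
    [mu = 0], and [sg = 0] would then make the point umbilic. *)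
Lemma second_form_asymptotic x y : U x y ->
  let n := pt (fr 3) x y in
  let L := LL f x y n in let M := MM f x y n in let N := NN f x y n in
  let A := a x y in let B := b x y in let C := cc x y in let D := dd x y in
  A * A * L + 2 * A * B * M + B * B * N = 0 /\
  C * C * L + 2 * C * D * M + D * D * N = 0 /\
  A * C * L + (A * D + B * C) * M + B * D * N <> 0.
Proof.
  intros Hxy n L M N A B C D.
  destruct (metric_completion x y Hxy) as [M0 [[M1 M2] [[I1 [I2 [I3 I4]]] [R1 [R2 R3]]]]].
  destruct (Hsphere x y Hxy) as [_ HD].
  assert (Hn := fr3_unit_normal x y Hxy). fold n in Hn.
  assert (Hm := Hmin x y n Hxy Hn). assert (Hu := Humb x y n Hxy Hn).
  destruct (Hbis x y Hxy) as [_ Hb]. specialize (Hb n).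
  unfold principal_dir, IIform, Iform in Hb.
  subst L M N A B C D.
  set (L := LL f x y n) in *. set (M := MM f x y n) in *. set (N := NN f x y n) in *.
  set (A := a x y) in *. set (B := b x y) in *. set (C := cc x y) in *. set (D := dd x y) in *.
  clearbody A B C D L M N.
  set (E := EE f x y) in *. set (F := FF f x y) in *. set (G := GG f x y) in *.
  clearbody E F G.
  set (w1 := A * E + B * F) in *. set (w2 := C * E + D * F) in *.
  set (v1 := A * F + B * G) in *. set (v2 := C * F + D * G) in *.
  set (mu := A * A * L + 2 * A * B * M + B * B * N).
  set (sg := A * C * L + (A * D + B * C) * M + B * D * N).
  (* The trace in the orthonormal basis equals the coordinate trace, because [R1], [R2], [R3]
     express the inverse metric through the basis. *)
  assert (Htr : C * C * L + 2 * C * D * M + D * D * N = - mu).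
  { apply Rmult_eq_reg_r with (E * G - F ^ 2); [|lra].
    apply Rminus_diag_uniq. unfold mu.
    transitivity ((A * A + C * C) * (E * G - F ^ 2) * L
      + 2 * ((A * B + C * D) * (E * G - F ^ 2)) * M
      + (B * B + D * D) * (E * G - F ^ 2) * N); [ring|].
    rewrite R1, R2, R3, <- Hm. ring. }
  set (nu := C * C * L + 2 * C * D * M + D * D * N) in *.
  (* [(w1, v1)] and [(w2, v2)] are the covectors dual to [(A, B)] and [(C, D)]. [K1] to [K4] expand
     in them the second form contracted with the two basis vectors. *)
  assert (K1 : A * L + B * M = w1 * mu + w2 * sg).
  { transitivity (L * (A * (A * w1 + C * w2)) + M * (A * (B * w1 + D * w2) + B * (A * w1 + C * w2))
      + N * (B * (B * w1 + D * w2))); [rewrite I1, I2; ring | unfold mu, sg; ring]. }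
  assert (K2 : A * M + B * N = v1 * mu + v2 * sg).
  { transitivity (L * (A * (A * v1 + C * v2)) + M * (A * (B * v1 + D * v2) + B * (A * v1 + C * v2))
      + N * (B * (B * v1 + D * v2))); [rewrite I3, I4; ring | unfold mu, sg; ring]. }
  assert (K3 : C * L + D * M = w1 * sg + w2 * nu).
  { transitivity (L * (C * (A * w1 + C * w2)) + M * (C * (B * w1 + D * w2) + D * (A * w1 + C * w2))
      + N * (D * (B * w1 + D * w2))); [rewrite I1, I2; ring | unfold nu, sg; ring]. }
  assert (K4 : C * M + D * N = v1 * sg + v2 * nu).
  { transitivity (L * (C * (A * v1 + C * v2)) + M * (C * (B * v1 + D * v2) + D * (A * v1 + C * v2))
      + N * (D * (B * v1 + D * v2))); [rewrite I3, I4; ring | unfold nu, sg; ring]. }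
  assert (Hmu0 : mu = 0).
  { apply traceless_bisectrix with sg. intros lam p1 p2 Hp E1 E2.
    specialize (Hb (A * p1 + C * p2) (B * p1 + D * p2) Hn).
    assert (HI : (A * (A * p1 + C * p2) * E + (A * (B * p1 + D * p2) + B * (A * p1 + C * p2)) * F
       + B * (B * p1 + D * p2) * G) = p1).
    { transitivity (p1 * (A * A * E + (A * B + B * A) * F + B * B * G)
        + p2 * (A * C * E + (A * D + B * C) * F + B * D * G)); [ring | rewrite M0, M1; ring]. }
    assert (HII : (A * p1 + C * p2) * (A * p1 + C * p2) * E
       + ((A * p1 + C * p2) * (B * p1 + D * p2) + (B * p1 + D * p2) * (A * p1 + C * p2)) * F
       + (B * p1 + D * p2) * (B * p1 + D * p2) * G = p1 ^ 2 + p2 ^ 2).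
    { transitivity (p1 ^ 2 * (A * A * E + (A * B + B * A) * F + B * B * G)
        + 2 * p1 * p2 * (A * C * E + (A * D + B * C) * F + B * D * G)
        + p2 ^ 2 * (C * C * E + (C * D + D * C) * F + D * D * G));
        [ring | rewrite M0, M1, M2; ring]. }
    rewrite HI, HII, M0 in Hb.
    cut (p1 ^ 2 = / 2 * 1 * (p1 ^ 2 + p2 ^ 2)); [lra|]. apply Hb. split.
    - destruct (Req_dec (A * p1 + C * p2) 0) as [Z1|Z1]; [|now left].
      destruct (Req_dec (B * p1 + D * p2) 0) as [Z2|Z2]; [|now right].
      exfalso. rewrite Z1, Z2 in HI, HII.
      assert (S1 := pow2_ge_0 p1). assert (S2 := pow2_ge_0 p2).
      destruct Hp as [Hp|Hp]; apply pow2_gt_0 in Hp; lra.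
    - exists lam. intros r s.
      transitivity (r * (p1 * (A * L + B * M) + p2 * (C * L + D * M))
        + s * (p1 * (A * M + B * N) + p2 * (C * M + D * N))); [ring|].
      rewrite K1, K2, K3, K4, Htr.
      transitivity ((r * w1 + s * v1) * (mu * p1 + sg * p2) + (r * w2 + s * v2) * (sg * p1 - mu * p2));
        [ring|].
      rewrite E1, E2. unfold w1, w2, v1, v2. ring. }
  split; [exact Hmu0|]. split; [lra|]. intros Hsg.
  (* With all entries zero, [L], [M], [N] vanish by independence of the basis, which is the umbilic
     condition with multiplier 0. *)
  apply Hu. exists 0. fold sg in Hsg. assert (Hnu : nu = 0) by lra.
  rewrite Hmu0, Hsg in K1, K2. rewrite Hsg, Hnu in K3, K4.
  assert (Hdet : A * D - B * C <> 0).
  { intros Hz. assert (HX : (A * D - B * C) * (w1 * v2 - v1 * w2) = 1); [|rewrite Hz in HX; lra].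
    transitivity ((A * w1 + C * w2) * (B * v1 + D * v2) - (B * w1 + D * w2) * (A * v1 + C * v2));
      [ring | rewrite I1, I2, I3, I4; ring]. }
  assert (ZL : (A * D - B * C) * L = 0).
  { transitivity (D * (A * L + B * M) - B * (C * L + D * M)); [ring | rewrite K1, K3; ring]. }
  assert (ZM : (A * D - B * C) * M = 0).
  { transitivity (D * (A * M + B * N) - B * (C * M + D * N)); [ring | rewrite K2, K4; ring]. }
  assert (ZN : (A * D - B * C) * N = 0).
  { transitivity (A * (C * M + D * N) - C * (A * M + B * N)); [ring | rewrite K2, K4; ring]. }
  destruct (Rmult_integral _ _ ZL); [contradiction|].
  destruct (Rmult_integral _ _ ZM); [contradiction|].
  destruct (Rmult_integral _ _ ZN); [contradiction|]. lra.
Qed.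

(** [om fr 1 3] and [om fr 2 3] are the second form with one argument fixed to [e1] or [e2]. As its
    diagonal vanishes, each keeps only the [tau] term. *)
Lemma shape_forms x y : U x y ->
  (forall c, om fr 1 3 c x y = tau x y * om fr 0 2 c x y) /\
  (forall c, om fr 2 3 c x y = tau x y * om fr 0 1 c x y) /\ tau x y <> 0.
Proof.
  intros Hxy.
  destruct (metric_completion x y Hxy) as [M0 [[M1 M2] [[I1 [I2 [I3 I4]]] _]]].
  destruct (second_form_asymptotic x y Hxy) as [A1 [A2 A3]].
  assert (E13 := fun c => pd_tangent_normal a b c x y Hsa Hsb Hxy).
  assert (E23 := fun c => pd_tangent_normal cc dd c x y smooth_cc smooth_dd Hxy).
  assert (E01 := fun c => dot_pd_tangent a b c x y).
  assert (E02 := fun c => dot_pd_tangent cc dd c x y).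
  cbv zeta in *.
  change (fun c => dotf (pdv c (tangent a b)) (fr 3) x y) with (fun c => om fr 1 3 c x y) in E13.
  assert (Et : tau x y = a x y * cc x y * LL f x y (pt (fr 3) x y)
    + (a x y * dd x y + b x y * cc x y) * MM f x y (pt (fr 3) x y)
    + b x y * dd x y * NN f x y (pt (fr 3) x y)).
  { unfold tau. change (om fr 1 3) with (fun c => dotf (pdv c (tangent a b)) (fr 3)).
    cbv beta. rewrite !E13. ring. }
  split; [|split; [|now rewrite Et]].
  - intros c. change (dotf (pdv c (tangent a b)) (fr 3) x y
      = tau x y * dotf (pdv c f) (tangent cc dd) x y).
    rewrite E13, E02, Et.
    set (L := LL f x y (pt (fr 3) x y)) in *. set (M := MM f x y (pt (fr 3) x y)) in *.
    set (N := NN f x y (pt (fr 3) x y)) in *.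
    set (A := a x y) in *. set (B := b x y) in *. set (C := cc x y) in *. set (D := dd x y) in *.
    set (E := EE f x y) in *. set (F := FF f x y) in *. set (G := GG f x y) in *.
    clearbody A B C D L M N E F G.
    destruct c.
    + transitivity (L * (A * (A * (A * E + B * F) + C * (C * E + D * F)))
        + M * (A * (B * (A * E + B * F) + D * (C * E + D * F)) + B * (A * (A * E + B * F) + C * (C * E + D * F)))
        + N * (B * (B * (A * E + B * F) + D * (C * E + D * F)))); [rewrite I1, I2; ring|].
      transitivity ((A * E + B * F) * (A * A * L + 2 * A * B * M + B * B * N)
        + (A * C * L + (A * D + B * C) * M + B * D * N) * (C * E + D * F));
        [ring | rewrite A1; ring].
    + transitivity (L * (A * (A * (A * F + B * G) + C * (C * F + D * G)))
        + M * (A * (B * (A * F + B * G) + D * (C * F + D * G)) + B * (A * (A * F + B * G) + C * (C * F + D * G)))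
        + N * (B * (B * (A * F + B * G) + D * (C * F + D * G)))); [rewrite I3, I4; ring|].
      transitivity ((A * F + B * G) * (A * A * L + 2 * A * B * M + B * B * N)
        + (A * C * L + (A * D + B * C) * M + B * D * N) * (C * F + D * G));
        [ring | rewrite A1; ring].
  - intros c. change (dotf (pdv c (tangent cc dd)) (fr 3) x y
      = tau x y * dotf (pdv c f) (tangent a b) x y).
    rewrite E23, E01, Et.
    set (L := LL f x y (pt (fr 3) x y)) in *. set (M := MM f x y (pt (fr 3) x y)) in *.
    set (N := NN f x y (pt (fr 3) x y)) in *.
    set (A := a x y) in *. set (B := b x y) in *. set (C := cc x y) in *. set (D := dd x y) in *.
    set (E := EE f x y) in *. set (F := FF f x y) in *. set (G := GG f x y) in *.
    clearbody A B C D L M N E F G.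
    destruct c.
    + transitivity (L * (C * (A * (A * E + B * F) + C * (C * E + D * F)))
        + M * (C * (B * (A * E + B * F) + D * (C * E + D * F)) + D * (A * (A * E + B * F) + C * (C * E + D * F)))
        + N * (D * (B * (A * E + B * F) + D * (C * E + D * F)))); [rewrite I1, I2; ring|].
      transitivity ((C * E + D * F) * (C * C * L + 2 * C * D * M + D * D * N)
        + (A * C * L + (A * D + B * C) * M + B * D * N) * (A * E + B * F));
        [ring | rewrite A2; ring].
    + transitivity (L * (C * (A * (A * F + B * G) + C * (C * F + D * G)))
        + M * (C * (B * (A * F + B * G) + D * (C * F + D * G)) + D * (A * (A * F + B * G) + C * (C * F + D * G)))
        + N * (D * (B * (A * F + B * G) + D * (C * F + D * G)))); [rewrite I3, I4; ring|].
      transitivity ((C * F + D * G) * (C * C * L + 2 * C * D * M + D * D * N)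
        + (A * C * L + (A * D + B * C) * M + B * D * N) * (A * F + B * G));
        [ring | rewrite A2; ring].
Qed.

(** * Bisectrices that are circles are great circles *)

Hypothesis Hcirc : forall (c1 c2 : R -> R) (s0 s1 : R), s0 < s1 ->
  (forall s, s0 < s < s1 -> U (c1 s) (c2 s) /\
     is_derive c1 s (a (c1 s) (c2 s)) /\ is_derive c2 s (b (c1 s) (c2 s))) ->
  frenet_circle (fun i s => f i (c1 s) (c2 s)) s0 s1.

Definition along (g : R -> R -> R) (x y : R) : R := pdx g x y * a x y + pdy g x y * b x y.
Definition along_vec (u : surf) (x y : R) : vec4 := fun i => along (u i) x y.

Lemma dot_along u v x y : dot4 (along_vec u x y) (pt v x y)
  = a x y * dotf (pdv true u) v x y + b x y * dotf (pdv false u) v x y.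
Proof. unfold along_vec, along, dotf, dot4, pt, pdv, pd. ring. Qed.

Lemma ruling_forms x y : U x y ->
  a x y * om fr 0 1 true x y + b x y * om fr 0 1 false x y = 1 /\
  a x y * om fr 0 2 true x y + b x y * om fr 0 2 false x y = 0.
Proof.
  intros Hxy. destruct (metric_completion x y Hxy) as [M0 [[M1 _] _]].
  assert (E01 := fun c => dot_pd_tangent a b c x y).
  assert (E02 := fun c => dot_pd_tangent cc dd c x y).
  change (fr 1) with (tangent a b) in *.
  unfold om. change (fr 1) with (tangent a b). change (fr 2) with (tangent cc dd).
  change (fr 0) with f. rewrite !E01, !E02. split; lra.
Qed.

(* Along a bisectrix <N, e3> = 0 and N' = - kappa e1, hence <N, e3'> = - tau <N, e2> = 0. *)
Lemma ruling_geodesic x y : U x y ->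
  a x y * om fr 1 2 true x y + b x y * om fr 1 2 false x y = 0.
Proof.
  intros Hxy.
  destruct (planar_integral_curve U a b x y HU Hsa Hsb Hxy)
    as [h [c1 [c2 [Hh [Hc1 [Hc2 Hc]]]]]].
  destruct (Hcirc c1 c2 (- h) h ltac:(lra) Hc) as [kappa [N HN]].
  assert (Hfr := smooth_fr).
  assert (Hcurve : forall g s, smooth_on U g -> - h < s < h ->
    is_derive (fun s => g (c1 s) (c2 s)) s (along g (c1 s) (c2 s))).
  { intros g s Hg Hs. destruct (Hc s Hs) as [H1 [H2 H3]].
    now apply (smooth_curve U g c1 c2 s). }
  assert (HT : forall i s, (i < 4)%nat -> - h < s < h ->
    Derive (fun s => f i (c1 s) (c2 s)) s = fr 1 i (c1 s) (c2 s)).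
  { intros i s Hi Hs. rewrite (Derive_eta _ _ _ (Hcurve (f i) s (Hf i Hi) Hs)).
    unfold along, fr, tangent, pd. ring. }
  assert (HNa : forall s, - h < s < h -> forall i, (i < 4)%nat ->
    kappa * N i s = along (fr 1 i) (c1 s) (c2 s)).
  { intros s Hs i Hi. destruct (HN s Hs) as [HNi _]. destruct (HNi i Hi) as [_ [HD _]].
    rewrite <- (is_derive_unique _ _ _ HD).
    assert (Hg := Hcurve (fr 1 i) s (Hfr 1%nat ltac:(lia) i Hi) Hs).
    rewrite <- (is_derive_unique _ _ _ Hg).
    apply Derive_ext_loc.
    assert (Hd : 0 < Rmin (s + h) (h - s)) by (apply Rmin_glb_lt; lra).
    assert (Hb : forall t : R, Rabs (t - s) < Rmin (s + h) (h - s) ->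
      Derive (fun s => f i (c1 s) (c2 s)) t = fr 1 i (c1 t) (c2 t)).
    { intros t Ht. apply HT; [assumption|].
      assert (R1 := Rmin_l (s + h) (h - s)). assert (R2 := Rmin_r (s + h) (h - s)).
      apply Rabs_lt_between in Ht. lra. }
    exists (mkposreal _ Hd). exact Hb. }
  assert (HUc' : forall s, - h < s < h -> U (c1 s) (c2 s)) by (intros s Hs; apply (Hc s Hs)).
  assert (Hdot : forall s, - h < s < h -> forall v,
    kappa * dot4 (fun i => N i s) (pt v (c1 s) (c2 s))
    = a (c1 s) (c2 s) * dotf (pdv true (fr 1)) v (c1 s) (c2 s)
      + b (c1 s) (c2 s) * dotf (pdv false (fr 1)) v (c1 s) (c2 s)).
  { intros s Hs v. rewrite <- dot_along.
    transitivity (dot4 (fun i => kappa * N i s) (pt v (c1 s) (c2 s)));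
      [unfold dot4; ring|].
    apply dot4_ext; auto. }
  assert (Hskew : forall s j k c, - h < s < h -> (j < 4)%nat -> (k < 4)%nat ->
    om fr k j c (c1 s) (c2 s) = - om fr j k c (c1 s) (c2 s)).
  { intros s j k c Hs Hj Hk.
    apply (om_skew U fr HU Hfr fr_orthonormal); auto. }
  (* A unit speed curve on the unit sphere has acceleration with component -1 along the position, so
     it is not straight. *)
  assert (Hkappa : kappa <> 0).
  { intros Hk. assert (H0 : - h < 0 < h) by lra.
    assert (H := Hdot 0 H0 (fr 0)).
    change (dotf (pdv true (fr 1)) (fr 0)) with (om fr 1 0 true) in H.
    change (dotf (pdv false (fr 1)) (fr 0)) with (om fr 1 0 false) in H.
    rewrite !(Hskew 0 0%nat 1%nat) in H by (assumption || lia).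
    destruct (ruling_forms _ _ (HUc' 0 H0)) as [R1 _]. rewrite Hk in H. lra. }
  assert (HNn : forall s, - h < s < h -> dot4 (fun i => N i s) (pt (fr 3) (c1 s) (c2 s)) = 0).
  { intros s Hs. assert (H := Hdot s Hs (fr 3)).
    change (dotf (pdv true (fr 1)) (fr 3)) with (om fr 1 3 true) in H.
    change (dotf (pdv false (fr 1)) (fr 3)) with (om fr 1 3 false) in H.
    destruct (shape_forms _ _ (HUc' s Hs)) as [E13 _]. rewrite !E13 in H.
    destruct (ruling_forms _ _ (HUc' s Hs)) as [_ R2].
    apply Rmult_eq_reg_l with kappa; [|assumption]. rewrite H, Rmult_0_r.
    transitivity (tau (c1 s) (c2 s) * (a (c1 s) (c2 s) * om fr 0 2 true (c1 s) (c2 s)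
      + b (c1 s) (c2 s) * om fr 0 2 false (c1 s) (c2 s))); [ring | rewrite R2; ring]. }
  assert (H0 : - h < 0 < h) by lra.
  assert (HD : is_derive (fun s => dot4 (fun i => N i s) (pt (fr 3) (c1 s) (c2 s))) 0
    (dot4 (fun i => - kappa * fr 1 i (c1 0) (c2 0)) (pt (fr 3) (c1 0) (c2 0))
     + dot4 (fun i => N i 0) (along_vec (fr 3) (c1 0) (c2 0)))).
  { assert (HNd : forall i, (i < 4)%nat -> is_derive (N i) 0 (- kappa * fr 1 i (c1 0) (c2 0))).
    { intros i Hi. rewrite <- HT by assumption.
      destruct (HN 0 H0) as [HNi _]. apply (HNi i Hi). }
    assert (Hnd : forall i, (i < 4)%nat ->
      is_derive (fun s => fr 3 i (c1 s) (c2 s)) 0 (along (fr 3 i) (c1 0) (c2 0)))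
      by (intros i Hi; apply Hcurve; [apply (Hfr 3%nat); lia | assumption]).
    assert (Hprod : forall i, (i < 4)%nat ->
      is_derive (fun s => N i s * fr 3 i (c1 s) (c2 s)) 0
        (- kappa * fr 1 i (c1 0) (c2 0) * fr 3 i (c1 0) (c2 0)
         + N i 0 * along (fr 3 i) (c1 0) (c2 0))).
    { intros i Hi. exact (is_derive_mult (N i) (fun s => fr 3 i (c1 s) (c2 s)) 0 _ _
        (HNd i Hi) (Hnd i Hi) Rmult_comm). }
    unfold dot4, pt, along_vec.
    match goal with |- is_derive _ _ ?l => replace l with
      (- kappa * fr 1 0%nat (c1 0) (c2 0) * fr 3 0%nat (c1 0) (c2 0)
         + N 0%nat 0 * along (fr 3 0%nat) (c1 0) (c2 0)
       + (- kappa * fr 1 1%nat (c1 0) (c2 0) * fr 3 1%nat (c1 0) (c2 0)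
         + N 1%nat 0 * along (fr 3 1%nat) (c1 0) (c2 0))
       + (- kappa * fr 1 2%nat (c1 0) (c2 0) * fr 3 2%nat (c1 0) (c2 0)
         + N 2%nat 0 * along (fr 3 2%nat) (c1 0) (c2 0))
       + (- kappa * fr 1 3%nat (c1 0) (c2 0) * fr 3 3%nat (c1 0) (c2 0)
         + N 3%nat 0 * along (fr 3 3%nat) (c1 0) (c2 0))) by ring end.
    exact (is_derive_plus _ _ _ _ _ (is_derive_plus _ _ _ _ _ (is_derive_plus _ _ _ _ _
      (Hprod 0%nat ltac:(lia)) (Hprod 1%nat ltac:(lia))) (Hprod 2%nat ltac:(lia)))
      (Hprod 3%nat ltac:(lia))). }
  assert (HZ : is_derive (fun s => dot4 (fun i => N i s) (pt (fr 3) (c1 s) (c2 s))) 0 0).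
  { apply is_derive_ext_loc with (fun _ => 0); [|apply (is_derive_const 0)].
    assert (Hb : forall t : R, Rabs (t - 0) < h ->
      0 = dot4 (fun i => N i t) (pt (fr 3) (c1 t) (c2 t))).
    { intros t Ht. symmetry. apply HNn. apply Rabs_lt_between in Ht. lra. }
    exists (mkposreal h Hh). exact Hb. }
  assert (HDZ := is_derive_unique _ _ _ HD). rewrite (is_derive_unique _ _ _ HZ) in HDZ.
  assert (Hzero : dot4 (fun i => N i 0) (along_vec (fr 3) (c1 0) (c2 0)) = 0).
  { assert (H13 := fr_orthonormal _ _ (HUc' 0 H0) 1%nat 3%nat ltac:(lia) ltac:(lia)).
    unfold kron in H13; simpl Nat.eqb in H13; cbv iota in H13.
    assert (Hz : dot4 (fun i => - kappa * fr 1 i (c1 0) (c2 0)) (pt (fr 3) (c1 0) (c2 0)) = 0).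
    { transitivity (- kappa * dot4 (frame_at fr (c1 0) (c2 0) 1%nat)
        (frame_at fr (c1 0) (c2 0) 3%nat)); [unfold dot4, frame_at, pt; ring|].
      rewrite H13. ring. }
    rewrite Hz in HDZ. lra. }
  rewrite <- Hc1, <- Hc2.
  set (p1 := c1 0) in *. set (p2 := c2 0) in *.
  assert (Hp := HUc' 0 H0). fold p1 p2 in Hp.
  (* [<e1', e3'> = 0] expanded in the frame: the position and diagonal terms vanish, and the single
     remaining product is [om 1 2] times [om 3 2], both evaluated on [e1]. *)
  assert (Hpars : dot4 (fun k => dot4 (along_vec (fr 1) p1 p2) (frame_at fr p1 p2 k))
     (fun k => dot4 (along_vec (fr 3) p1 p2) (frame_at fr p1 p2 k)) = 0).
  { rewrite <- (parseval (frame_at fr p1 p2) _ _ (fr_orthonormal p1 p2 Hp)).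
    transitivity (kappa * dot4 (fun i => N i 0) (along_vec (fr 3) p1 p2));
      [|rewrite Hzero; ring].
    transitivity (dot4 (fun i => kappa * N i 0) (along_vec (fr 3) p1 p2));
      [|unfold dot4; ring].
    apply dot4_ext; auto. intros i Hi. symmetry. now apply HNa. }
  assert (Hom : forall j k, dot4 (along_vec (fr j) p1 p2) (frame_at fr p1 p2 k)
    = a p1 p2 * om fr j k true p1 p2 + b p1 p2 * om fr j k false p1 p2)
    by (intros; apply dot_along).
  unfold dot4 at 1 in Hpars. rewrite !Hom in Hpars.
  assert (Hd : forall j c, (j < 4)%nat -> om fr j j c p1 p2 = 0)
    by (intros j c Hj; assert (H := Hskew 0 j j c H0 Hj Hj); fold p1 p2 in H; lra).
  assert (H03 : forall c, om fr 0 3 c p1 p2 = 0) by (intros c; now apply dot_pd_normal).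
  assert (S30 : forall c, om fr 3 0 c p1 p2 = - om fr 0 3 c p1 p2)
    by (intros c; apply (Hskew 0); (assumption || lia)).
  assert (S32 : forall c, om fr 3 2 c p1 p2 = - om fr 2 3 c p1 p2)
    by (intros c; apply (Hskew 0); (assumption || lia)).
  rewrite !Hd, !S30, !S32, !H03 in Hpars by lia.
  destruct (shape_forms p1 p2 Hp) as [_ [E23 Ht0]]. rewrite !E23 in Hpars.
  destruct (ruling_forms p1 p2 Hp) as [R1 _].
  apply Rmult_eq_reg_r with (tau p1 p2); [|assumption].
  transitivity ((a p1 p2 * om fr 1 2 true p1 p2 + b p1 p2 * om fr 1 2 false p1 p2) * tau p1 p2
    * (a p1 p2 * om fr 0 1 true p1 p2 + b p1 p2 * om fr 0 1 false p1 p2)); [rewrite R1; ring|].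
  lra.
Qed.

(** The function [q] of the structure equations: [om fr 1 2] on [e2], up to sign the geodesic
    curvature of the curves orthogonal to the rulings. *)
Definition turning : R -> R -> R := fun x y =>
  cc x y * om fr 1 2 true x y + dd x y * om fr 1 2 false x y.

Lemma smooth_om_fr j k c : (j < 4)%nat -> (k < 4)%nat -> smooth_on U (om fr j k c).
Proof. intros Hj Hk. apply (smooth_om U fr HU smooth_fr); assumption. Qed.

Lemma smooth_turning : smooth_on U turning.
Proof.
  assert (HC := smooth_cc). assert (HD := smooth_dd).
  assert (H1 := smooth_om_fr 1 2 true ltac:(lia) ltac:(lia)).
  assert (H2 := smooth_om_fr 1 2 false ltac:(lia) ltac:(lia)).
  unfold turning. smooth.
Qed.

Lemma smooth_tau : smooth_on U tau.
Proof.
  assert (HC := smooth_cc). assert (HD := smooth_dd).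
  assert (H1 := smooth_om_fr 1 3 true ltac:(lia) ltac:(lia)).
  assert (H2 := smooth_om_fr 1 3 false ltac:(lia) ltac:(lia)).
  unfold tau. smooth.
Qed.

Lemma coframe_dual x y : U x y ->
  a x y * om fr 0 1 true x y + cc x y * om fr 0 2 true x y = 1 /\
  b x y * om fr 0 1 true x y + dd x y * om fr 0 2 true x y = 0 /\
  a x y * om fr 0 1 false x y + cc x y * om fr 0 2 false x y = 0 /\
  b x y * om fr 0 1 false x y + dd x y * om fr 0 2 false x y = 1.
Proof.
  intros Hxy. destruct (metric_completion x y Hxy) as [_ [_ [I _]]].
  change (om fr 0 1) with (fun c => dotf (pdv c f) (tangent a b)).
  change (om fr 0 2) with (fun c => dotf (pdv c f) (tangent cc dd)). cbv beta.
  rewrite !dot_pd_tangent. exact I.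
Qed.

(** Expansion of the form in the dual coframe; its coefficient on [w1] is its value on [e1], which
    vanishes by [ruling_geodesic]. *)
Lemma turning_form x y c : U x y -> om fr 1 2 c x y = turning x y * om fr 0 2 c x y.
Proof.
  intros Hxy. destruct (coframe_dual x y Hxy) as [I1 [I2 [I3 I4]]].
  assert (Hz := ruling_geodesic x y Hxy). unfold turning. destruct c.
  - transitivity ((a x y * om fr 0 1 true x y + cc x y * om fr 0 2 true x y) * om fr 1 2 true x y
      + (b x y * om fr 0 1 true x y + dd x y * om fr 0 2 true x y) * om fr 1 2 false x y
      - om fr 0 1 true x y * (a x y * om fr 1 2 true x y + b x y * om fr 1 2 false x y));
      [rewrite I1, I2, Hz; ring | ring].
  - transitivity ((a x y * om fr 0 1 false x y + cc x y * om fr 0 2 false x y) * om fr 1 2 true x y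
      + (b x y * om fr 0 1 false x y + dd x y * om fr 0 2 false x y) * om fr 1 2 false x y
      - om fr 0 1 false x y * (a x y * om fr 1 2 true x y + b x y * om fr 1 2 false x y));
      [rewrite I3, I4, Hz; ring | ring].
Qed.

(** The coframe matrix is inverse to the matrix of the frame coefficients, so the two determinants
    have product 1. *)
Lemma area_form_nonzero x y : U x y ->
  om fr 0 1 true x y * om fr 0 2 false x y - om fr 0 1 false x y * om fr 0 2 true x y <> 0.
Proof.
  intros Hxy Hz. destruct (coframe_dual x y Hxy) as [I1 [I2 [I3 I4]]].
  assert (H : (a x y * dd x y - b x y * cc x y) *
    (om fr 0 1 true x y * om fr 0 2 false x y - om fr 0 1 false x y * om fr 0 2 true x y) = 1).
  { transitivity ((a x y * om fr 0 1 true x y + cc x y * om fr 0 2 true x y)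
      * (b x y * om fr 0 1 false x y + dd x y * om fr 0 2 false x y)
      - (b x y * om fr 0 1 true x y + dd x y * om fr 0 2 true x y)
      * (a x y * om fr 0 1 false x y + cc x y * om fr 0 2 false x y));
      [ring | rewrite I1, I2, I3, I4; ring]. }
  rewrite Hz in H. lra.
Qed.

Lemma torus_ruled_frame : ruled_frame U fr (om fr 0 1) (om fr 0 2) turning tau.
Proof.
  apply ruled_frame_of_forms; auto using smooth_fr, fr_orthonormal, smooth_turning, smooth_tau,
    area_form_nonzero, turning_form.
  - intros c x y Hxy. now apply dot_pd_normal.
  - intros c x y Hxy. now apply shape_forms.
  - intros c x y Hxy. now apply shape_forms.
  - intros x y Hxy. now apply shape_forms.
Qed.

End TorusFrame.

(** * Gauss curvature *)

Lemma pd2_dotf U c d u v x y : open2 U -> smv U u -> smv U v -> U x y ->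
  pd c (pd d (dotf u v)) x y =
  dotf (pdv c (pdv d u)) v x y + dotf (pdv d u) (pdv c v) x y
  + (dotf (pdv c u) (pdv d v) x y + dotf u (pdv c (pdv d v)) x y).
Proof.
  intros HU Hu Hv Hxy.
  assert (Hu' := smooth_pdv U d u Hu). assert (Hv' := smooth_pdv U d v Hv).
  rewrite (pd_ext U (pd d (dotf u v)) (fun x y => dotf (pdv d u) v x y + dotf u (pdv d v) x y));
    auto.
  - rewrite (pd_plus U c (dotf (pdv d u) v) (dotf u (pdv d v))); auto using smooth_dotf.
    rewrite !(pd_dotf U); auto.
  - intros; now apply (pd_dotf U).
Qed.

Lemma dotf_comm U c d u v x y : open2 U -> smv U u -> U x y ->
  dotf (pdv c (pdv d u)) v x y = dotf (pdv d (pdv c u)) v x y.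
Proof.
  intros HU Hu Hxy. apply dot4_ext; auto. intros i Hi.
  exact (pd_comm U c d (u i) x y HU (Hu i Hi) Hxy).
Qed.

Lemma pdv_comm_eq U c d u x y i : open2 U -> smv U u -> (i < 4)%nat -> U x y ->
  pdv c (pdv d u) i x y = pdv d (pdv c u) i x y.
Proof. intros HU Hu Hi Hxy. exact (pd_comm U c d (u i) x y HU (Hu i Hi) Hxy). Qed.

Section Gauss.
Variables (U : R -> R -> Prop) (e : nat -> surf) (tau : R -> R -> R).
Hypothesis HU : open2 U.
Hypothesis He : forall k, (k < 4)%nat -> smv U (e k).
Hypothesis Ho : forall x y, U x y -> orthonormal (frame_at e x y).
Hypothesis H03 : forall b x y, U x y -> om e 0 3 b x y = 0.
Hypothesis H13 : forall b x y, U x y -> om e 1 3 b x y = tau x y * om e 0 2 b x y.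
Hypothesis H23 : forall b x y, U x y -> om e 2 3 b x y = tau x y * om e 0 1 b x y.
Hypothesis HJ : forall x y, U x y ->
  om e 0 1 true x y * om e 0 2 false x y - om e 0 1 false x y * om e 0 2 true x y <> 0.

Lemma om_0 c k x y : U x y -> (k = 0 \/ k = 3)%nat -> om e 0 k c x y = 0.
Proof.
  intros Hxy [->| ->]; [|now apply H03].
  apply (om_diag U e HU He Ho); auto with arith.
Qed.

(** The position and the normal are orthogonal to the first derivatives of the position.
    Differentiating this relation moves one derivative onto [e k], and Parseval leaves only
    tangential terms. *)
Lemma hessian_component c d k x y : U x y -> (k = 0 \/ k = 3)%nat ->
  dotf (pdv c (pdv d (e 0%nat))) (e k) x y
  = - (om e 0 1 d x y * om e k 1 c x y + om e 0 2 d x y * om e k 2 c x y).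
Proof.
  intros Hxy Hk.
  assert (Hk4 : (k < 4)%nat) by lia.
  assert (H0 : (0 < 4)%nat) by lia.
  assert (H := pd_dotf U c (pdv d (e 0%nat)) (e k) x y HU
    (smooth_pdv U d _ (He 0%nat H0)) (He k Hk4) Hxy).
  rewrite (pd_ext U (dotf (pdv d (e 0%nat)) (e k)) (fun _ _ => 0)), pd_const in H;
    [|assumption|intros u v Huv; now apply om_0|assumption].
  assert (Hp := parseval (frame_at e x y) (pt (pdv d (e 0%nat)) x y) (pt (pdv c (e k)) x y)
    (Ho x y Hxy)).
  change (dotf (pdv d (e 0%nat)) (pdv c (e k)) x y
    = dot4 (fun m => om e 0 m d x y) (fun m => om e k m c x y)) in Hp.
  unfold dot4 in Hp. rewrite (om_0 d 0), (om_0 d 3) in Hp by auto. lra.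
Qed.

Lemma metric_component c d x y : U x y ->
  dotf (pdv c (e 0%nat)) (pdv d (e 0%nat)) x y
  = om e 0 1 c x y * om e 0 1 d x y + om e 0 2 c x y * om e 0 2 d x y.
Proof.
  intros Hxy.
  assert (Hp := parseval (frame_at e x y) (pt (pdv c (e 0%nat)) x y) (pt (pdv d (e 0%nat)) x y)
    (Ho x y Hxy)).
  change (dotf (pdv c (e 0%nat)) (pdv d (e 0%nat)) x y
    = dot4 (fun m => om e 0 m c x y) (fun m => om e 0 m d x y)) in Hp.
  rewrite Hp. unfold dot4. rewrite !(om_0 _ 0), !(om_0 _ 3) by auto. ring.
Qed.

Lemma frame_dot_first v d x y : U x y -> dotf v (pdv d (e 0%nat)) x y
  = dotf v (e 1%nat) x y * om e 0 1 d x y + dotf v (e 2%nat) x y * om e 0 2 d x y.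
Proof.
  intros Hxy.
  assert (Hp := parseval (frame_at e x y) (pt v x y) (pt (pdv d (e 0%nat)) x y) (Ho x y Hxy)).
  change (dotf v (pdv d (e 0%nat)) x y
    = dot4 (fun m => dotf v (e m) x y) (fun m => om e 0 m d x y)) in Hp.
  rewrite Hp. unfold dot4. rewrite (om_0 _ 0), (om_0 _ 3) by auto. ring.
Qed.

Lemma frame_dot v w x y : U x y -> dotf v w x y
  = dotf v (e 0%nat) x y * dotf w (e 0%nat) x y + dotf v (e 1%nat) x y * dotf w (e 1%nat) x y
    + dotf v (e 2%nat) x y * dotf w (e 2%nat) x y + dotf v (e 3%nat) x y * dotf w (e 3%nat) x y.
Proof.
  intros Hxy. exact (parseval (frame_at e x y) (pt v x y) (pt w x y) (Ho x y Hxy)).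
Qed.

(* Brioschi's determinants are the Gram determinants of the second derivatives of the position
   and the tangent vectors; in the frame their tangential parts cancel, the position components
   give the curvature 1 of the sphere and the normal components give - tau^2. *)
Lemma gauss_curv_frame x y : U x y -> gauss_curv (e 0%nat) x y = 1 - tau x y ^ 2.
Proof.
  intros Hxy.
  set (f := e 0%nat). assert (Hf : smv U f) by (apply He; lia).
  assert (Hf1 : forall c, smv U (pdv c f)) by (intros; now apply smooth_pdv).
  assert (Hf2 : forall c d, smv U (pdv c (pdv d f))) by (intros; now apply smooth_pdv).
  set (fxx' := pdv true (pdv true f)). set (fxy' := pdv false (pdv true f)).
  set (fyy' := pdv false (pdv false f)).
  assert (Hmix : forall v, dotf (pdv true (pdv false f)) v x y = dotf fxy' v x y)
    by (intros; now apply (dotf_comm U)).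
  unfold gauss_curv. cbv zeta.
  change (EE f) with (dotf (pdv true f) (pdv true f)).
  change (FF f) with (dotf (pdv true f) (pdv false f)).
  change (GG f) with (dotf (pdv false f) (pdv false f)).
  change pdx with (pd true). change pdy with (pd false).
  rewrite !(pd2_dotf U) by auto. rewrite !(pd_dotf U) by auto.
  fold fxx' fxy' fyy'.
  (* [T1] and [T2] bring the third derivatives of the position to one order of differentiation, in
     which those from [F_xy], [E_yy] and [G_xx] cancel. *)
  assert (T1 : dotf (pdv false (pdv true (pdv false f))) (pdv true f) x y
     = dotf (pdv false fxy') (pdv true f) x y).
  { apply dot4_ext; auto. intros i Hi.
    apply (pd_ext U); auto. intros u v Huv. now apply (pdv_comm_eq U). }
  assert (T2 : dotf (pdv true (pdv true (pdv false f))) (pdv false f) x y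
     = dotf (pdv false fxx') (pdv false f) x y).
  { transitivity (dotf (pdv true fxy') (pdv false f) x y).
    - apply dot4_ext; auto. intros i Hi.
      apply (pd_ext U); auto. intros u v Huv. now apply (pdv_comm_eq U).
    - apply (dotf_comm U); auto. }
  rewrite ?(dotf_sym (pdv true f) (pdv false (pdv true (pdv false f)))),
    ?(dotf_sym (pdv true f) (pdv false fxy')),
    ?(dotf_sym (pdv false f) (pdv true (pdv true (pdv false f)))), ?T1, ?T2.
  rewrite ?Hmix.
  rewrite ?(dotf_sym _ (pdv true (pdv false f))), ?Hmix.
  rewrite ?(dotf_sym (pdv true f) fxx'), ?(dotf_sym (pdv true f) fxy'),
    ?(dotf_sym (pdv true f) fyy'), ?(dotf_sym (pdv false f) fxx'),
    ?(dotf_sym (pdv false f) fxy'), ?(dotf_sym (pdv false f) fyy'),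
    ?(dotf_sym (pdv false f) (pdv true f)), ?(dotf_sym fyy' fxx').
  assert (Hnn : forall c d, dotf (pdv c (pdv d f)) (e 3%nat) x y
    = tau x y * (om e 0 1 d x y * om e 0 2 c x y + om e 0 2 d x y * om e 0 1 c x y)).
  { intros c d. rewrite hessian_component by auto.
    rewrite !(om_skew U e HU He Ho 1 3), !(om_skew U e HU He Ho 2 3) by (auto with arith).
    rewrite H13, H23 by assumption. ring. }
  assert (Hpp : forall c d, dotf (pdv c (pdv d f)) (e 0%nat) x y
    = - (om e 0 1 d x y * om e 0 1 c x y + om e 0 2 d x y * om e 0 2 c x y)).
  { intros c d. rewrite hessian_component by auto. reflexivity. }
  rewrite (frame_dot fxx' fyy'), (frame_dot fxy' fxy') by assumption.
  unfold f. rewrite !(metric_component _ _ x y Hxy), !(frame_dot_first _ _ x y Hxy).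
  fold f. unfold fxx', fxy', fyy'. rewrite !Hnn, !Hpp. fold fxx' fxy' fyy'.
  generalize (dotf fxx' (e 1%nat) x y) (dotf fxx' (e 2%nat) x y)
    (dotf fxy' (e 1%nat) x y) (dotf fxy' (e 2%nat) x y)
    (dotf fyy' (e 1%nat) x y) (dotf fyy' (e 2%nat) x y)
    (dotf (pdv false fxy') (e 1%nat) x y) (dotf (pdv false fxy') (e 2%nat) x y)
    (dotf (pdv false fxx') (e 1%nat) x y) (dotf (pdv false fxx') (e 2%nat) x y).
  assert (HJ' := HJ x y Hxy). revert HJ'.
  generalize (om e 0 1 true x y) (om e 0 1 false x y) (om e 0 2 true x y) (om e 0 2 false x y)
    (tau x y).
  intros p p' r r' t HJ' X1 X2 Y1 Y2 Z1 Z2 V1 V2 V3 V4. unfold det3. field.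
  (* The denominator [E G - F^2] is the square of the coefficient of the area form. *)
  intros Hz. apply HJ'.
  assert (HZ : (p * r' - p' * r) ^ 2 = 0) by lra.
  simpl in HZ. rewrite Rmult_1_r in HZ. now destruct (Rmult_integral _ _ HZ).
Qed.

End Gauss.

(** * Reversal of the normal and choice of sign *)

Section Flip.
Variables (U : R -> R -> Prop) (e : nat -> surf) (w1 w2 : bool -> R -> R -> R)
  (q tau : R -> R -> R).
Hypothesis HU : open2 U.
Hypothesis He : forall k, (k < 4)%nat -> smv U (e k).
Hypothesis Ho : forall x y, U x y -> orthonormal (frame_at e x y).
Hypothesis Hfr : ruled_frame U e w1 w2 q tau.

(** Reversing the normal negates [tau] and keeps [q] and the coframe, which brings a surface with
    [tau < 0] under the comparison stated for [tau > 0]. *)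
Definition flip (k : nat) : surf := match k with 3%nat => fun i x y => - e 3%nat i x y | _ => e k end.

Lemma smooth_flip k : (k < 4)%nat -> smv U (flip k).
Proof.
  intros Hk. nat4 k Hk; [exact (He 0%nat Hk) | exact (He 1%nat Hk) | exact (He 2%nat Hk) |].
  intros i Hi. exact (smooth_opp U (e 3%nat i) HU (He 3%nat Hk i Hi)).
Qed.

Lemma flip_orthonormal x y : U x y -> orthonormal (frame_at flip x y).
Proof.
  intros Hxy j k Hj Hk. assert (H := Ho x y Hxy j k Hj Hk). rewrite <- H.
  assert (H30 := Ho x y Hxy 3%nat 0%nat). assert (H31 := Ho x y Hxy 3%nat 1%nat).
  assert (H32 := Ho x y Hxy 3%nat 2%nat).
  unfold kron in *; simpl in H30, H31, H32.
  specialize (H30 ltac:(lia) ltac:(lia)). specialize (H31 ltac:(lia) ltac:(lia)).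
  specialize (H32 ltac:(lia) ltac:(lia)).
  unfold frame_at, pt, dot4 in *.
  nat4 j Hj; nat4 k Hk; simpl; lra.
Qed.

Lemma flip_ruled_frame : ruled_frame U flip w1 w2 q (fun x y => - tau x y).
Proof.
  intros b x y Hxy. destruct (Hfr b x y Hxy) as [H1 [H2 H3]].
  assert (Hopp : forall g, pd b (fun x y => - g x y) x y = - pd b g x y)
    by (intros g; destruct b; unfold pd, pdx, pdy; apply Derive_opp).
  split; [|rewrite Hopp, H2, H3; split; ring].
  intros i Hi. destruct (H1 i Hi) as [E0 [E1 [E2 E3]]]. simpl.
  rewrite Hopp, E0, E1, E2, E3. repeat split; ring.
Qed.

End Flip.

Lemma connected_sign (U : R -> R -> Prop) g : open2 U -> connected2 U -> smooth_on U g ->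
  (forall x y, U x y -> g x y <> 0) ->
  (forall x y, U x y -> 0 < g x y) \/ (forall x y, U x y -> g x y < 0).
Proof.
  intros HU HC Hg Hne.
  assert (Hopen : forall h, smooth_on U h -> open2 (fun x y => U x y /\ 0 < h x y)).
  { intros h Hh x y [Hxy Hp]. destruct (HU x y Hxy) as [e1 [He1 H1]].
    destruct (smooth_C1 U h x y Hh Hxy) as [_ Hc].
    destruct (Hc (mkposreal _ Hp)) as [e2 H2]. simpl in H2.
    exists (Rmin e1 e2). split; [apply Rmin_glb_lt; [assumption | apply cond_pos]|].
    intros u v Hu Hv. assert (M1 := Rmin_l e1 e2). assert (M2 := Rmin_r e1 e2).
    split; [apply H1; lra|].
    assert (H := H2 u v ltac:(lra) ltac:(lra)). apply Rabs_lt_between in H. lra. }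
  destruct (HC (fun x y => U x y /\ 0 < g x y) (fun x y => U x y /\ 0 < - g x y)) as [H|H].
  - now apply Hopen.
  - apply (Hopen (fun x y => - g x y)). now apply smooth_opp.
  - intros x y Hxy. assert (H := Hne x y Hxy). destruct (Rdichotomy _ _ H); [right|left]; split;
      auto; lra.
  - intros x y Hxy [_ H1] [_ H2]. lra.
  - left. intros x y Hxy. now apply H.
  - right. intros x y Hxy. destruct (H x y Hxy). lra.
Qed.

Theorem theorem2p3 (U : R -> R -> Prop) (f : surf) :
  gen_torus_first_type U f ->
  (exists x1 y1 x2 y2, U x1 y1 /\ U x2 y2 /\ gauss_curv f x1 y1 <> gauss_curv f x2 y2) ->
  exists alpha, 0 < alpha /\ alpha <> 1 /\
    exists A, orthogonal4 A /\
      forall x y, U x y -> exists s t,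
        forall i, (i < 4)%nat -> f i x y = mat_app A (lawson alpha s t) i.
Proof.
  intros [[HU [HC [_ [Hf Hs]]]] [Hmin [Humb [a [b [Ha [Hb [Hbis Hcirc]]]]]]]] HK.
  set (e := fr f a b). set (q := turning f a b). set (ta := tau f a b).
  assert (He : forall k, (k < 4)%nat -> smv U (e k))
    by (intros; now apply smooth_fr).
  assert (Ho : forall x y, U x y -> orthonormal (frame_at e x y))
    by (intros; now apply fr_orthonormal with U).
  assert (Hfr : ruled_frame U e (om e 0 1) (om e 0 2) q ta)
    by now apply torus_ruled_frame.
  assert (Hq : smooth_on U q) by now apply smooth_turning.
  assert (Ht : smooth_on U ta) by now apply smooth_tau.
  assert (Hsh : forall x y, U x y ->
    (forall c, om e 1 3 c x y = ta x y * om e 0 2 c x y) /\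
    (forall c, om e 2 3 c x y = ta x y * om e 0 1 c x y) /\ ta x y <> 0)
    by (intros; now apply shape_forms with U).
  assert (Hgauss : forall x y, U x y -> gauss_curv f x y = 1 - ta x y ^ 2).
  { intros x y Hxy. apply (gauss_curv_frame U e ta); auto.
    - intros c u v Huv. now apply (dot_pd_normal U).
    - intros c u v Huv. now apply Hsh.
    - intros c u v Huv. now apply Hsh.
    - intros u v Huv. now apply area_form_nonzero with U. }
  (* As the curvature is [1 - tau^2], two different values leave a point with [tau^2] different from
     1. This point serves as base point for the comparison, whichever sign the normal takes. *)
  assert (Hne : exists x0 y0, U x0 y0 /\ ta x0 y0 ^ 2 <> 1).
  { destruct HK as [x1 [y1 [x2 [y2 [H1 [H2 HKne]]]]]].
    destruct (Req_dec (ta x1 y1 ^ 2) 1) as [E1|E1]; [|now exists x1, y1].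
    exists x2, y2. split; [assumption|]. intros E2. apply HKne.
    rewrite !Hgauss by assumption. lra. }
  destruct Hne as [x0 [y0 [H0 Hne]]].
  assert (Hw : forall k c, (k < 4)%nat -> smooth_on U (om e 0 k c))
    by (intros; apply smooth_om with (U := U); auto with arith).
  assert (Hfin : (exists alpha, 1 < alpha /\ exists A, orthogonal4 A /\
    forall x y, U x y -> exists s t,
      forall i, (i < 4)%nat -> f i x y = mat_app A (lawson alpha s t) i)).
  { destruct (connected_sign U ta HU HC Ht) as [Hpos|Hneg].
    - intros; now apply Hsh.
    - apply (lawson_of_ruled_frame U e (om e 0 1) (om e 0 2) q ta) with x0 y0;
        auto with arith. right. intros E. apply Hne. rewrite E. ring.
    - apply (lawson_of_ruled_frame U (flip e) (om e 0 1) (om e 0 2) q (fun x y => - ta x y))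
        with x0 y0; auto with arith.
      + intros; now apply smooth_flip.
      + now apply smooth_opp.
      + intros; now apply flip_orthonormal with U.
      + now apply flip_ruled_frame.
      + intros x y Hxy. specialize (Hneg x y Hxy). lra.
      + right. intros E. apply Hne. replace (ta x0 y0) with (-1) by lra. ring. }
  destruct Hfin as [alpha [Halpha H]]. exists alpha.
  split; [lra|]. split; [lra|]. exact H.
Qed.
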